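(* Let $U:\mathscr{A}\to\mathscr{X}$ be a monadic functor with $\mathscr{A}$ a Barr exact category and $\mathscr{X}$ a semi-abelian category, such that the monad on $\mathscr{X}$ corresponding to $U$ is essentially nullary. Then, for every object $A$ in $\mathscr{A}$, the following (possibly large) lattices are canonically isomorphic to each other: (a) $\mathrm{Quot}(A)$, consisting of quotient objects of $A$; (b) $\mathrm{ERel}(A)$, consisting of equivalence relations on $A$; (c) $\mathrm{RRel}(A)$, consisting of reflexive relations on $A$; (d) $\mathrm{RRel}(U(A))$, consisting of reflexive relations on $U(A)$; (e) $\mathrm{ERel}(U(A))$, consisting of equivalence relations on $U(A)$; (f) $\mathrm{Quot}(U(A))$, consisting of quotient objects of $U(A)$; (g) $\mathrm{NSub}(U(A))$, consisting of normal subobjects of $U(A)$. In particular, this is the case for any ideally exact category $\mathscr{A}$, with $U:\mathscr{A}\to\mathscr{X}$ chosen to be a monadic functor with semi-abelian $\mathscr{X}$ such that the underlying functor of the corresponding monad preserves regular epimorphisms and kernel pairs, and the corresponding monad is cartesian and essentially nullary.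
   Context: A category is Barr exact if it has finite limits, it is regular (every kernel pair has a coequalizer and regular epimorphisms are pullback stable), and every equivalence relation in it is effective, i.e. is a kernel pair. A category with pullbacks is Bourn protomodular if for every morphism $v:B'\to B$ the pullback functor $v^*:\mathrm{Pt}(B)\to\mathrm{Pt}(B')$ reflects isomorphisms, where $\mathrm{Pt}(B)$ is the category of split epimorphisms into $B$ with chosen splitting (points over $B$). A category is semi-abelian if it has a zero object, is Barr exact and Bourn protomodular, and has finite coproducts. A functor $U:\mathscr{A}\to\mathscr{X}$ is monadic if it has a left adjoint and the comparison functor from $\mathscr{A}$ to the category of algebras of the induced monad on $\mathscr{X}$ is an equivalence. A monad $T=(T,\eta,\mu)$ on a category $\mathscr{X}$ with finite coproducts is essentially nullary if for every object $X$ the morphism $[T(!_X),\eta_X]:T(0)+X\to T(X)$ is a strong epimorphism, where $!_X:0\to X$ is the unique morphism from the initial object. A strong epimorphism is an epimorphism that is left orthogonal to all monomorphisms. A monad $(T,\eta,\mu)$ is cartesian if $T$ preserves pullbacks and all naturality squares of $\eta$ and $\mu$ are pullbacks. A category $\mathscr{A}$ is ideally exact if it is Barr exact and Bourn protomodular, has finite coproducts, and the unique morphism $0\to1$ from the initial to the terminal object is a regular epimorphism. Quotient objects are isomorphism classes of regular epimorphisms out of the given object, ordered by inclusion of their kernel pairs. Relations on an object $Y$ are subobjects of $Y\times Y$, i.e. isomorphism classes of jointly monic pairs $r_1,r_2:R\to Y$, ordered by inclusion; a relation is reflexive if there is $e:Y\to R$ with $r_1e=1_Y=r_2e$. Normal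 subobjects are subobjects represented by normal monomorphisms, i.e. kernels of morphisms, ordered by inclusion. The canonical maps are: $\mathrm{Quot}\to\mathrm{ERel}$, sending a quotient to its kernel pair; $\mathrm{ERel}\to\mathrm{RRel}$, the inclusion; $\mathrm{RRel}(A)\to\mathrm{RRel}(U(A))$, applying $U$; and $\mathrm{Quot}(U(A))\to\mathrm{NSub}(U(A))$, sending a quotient to its kernel. *)

(* Defs.v *)
From Stdlib Require Import List ProofIrrelevance.

Set Implicit Arguments.
Unset Strict Implicit.
Unset Printing Implicit Defensive.

Declare Scope cat_scope.
Delimit Scope cat_scope with cat.
Local Open Scope cat_scope.

(** * Categories, functors, natural transformations *)

Record category := Category {
  ob :> Type;
  hom : ob -> ob -> Type;
  idm : forall x, hom x x;
  comp : forall x y z, hom y z -> hom x y -> hom x z;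
  comp_idl : forall x y (f : hom x y), comp (idm y) f = f;
  comp_idr : forall x y (f : hom x y), comp f (idm x) = f;
  comp_assoc : forall w x y z (h : hom y z) (g : hom x y) (f : hom w x),
    comp h (comp g f) = comp (comp h g) f
}.
Arguments idm {c} x.
Arguments hom {c} x y.

Notation "g ∘ f" := (comp g f) (at level 40, left associativity) : cat_scope.

Record functor (C D : category) := Functor {
  fobj :> C -> D;
  fmap : forall x y : C, hom x y -> hom (fobj x) (fobj y);
  fmap_id : forall x, fmap (idm x) = idm (fobj x);
  fmap_comp : forall x y z (g : hom y z) (f : hom x y),
    fmap (g ∘ f) = fmap g ∘ fmap f
}.
Arguments fmap {C D} _ {x y} _.

Definition id_functor (C : category) : functor C C :=
  @Functor C C (fun x => x) (fun _ _ f => f)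
    (fun _ => eq_refl) (fun _ _ _ _ _ => eq_refl).

Definition comp_functor (C D E : category) (G : functor D E) (F : functor C D) :
  functor C E.
Proof.
  refine (@Functor C E (fun x => G (F x)) (fun _ _ f => fmap G (fmap F f)) _ _).
  - intros x; rewrite (fmap_id F); apply fmap_id.
  - intros x y z g f; rewrite (fmap_comp F); apply fmap_comp.
Defined.

Record nat_trans (C D : category) (F G : functor C D) := NatTrans {
  component :> forall x : C, hom (F x) (G x);
  naturality : forall (x y : C) (f : hom x y),
    component y ∘ fmap F f = fmap G f ∘ component x
}.

Definition is_iso (C : category) (x y : C) (f : hom x y) : Prop :=
  exists g : hom y x, g ∘ f = idm x /\ f ∘ g = idm y.

Definition naturally_isomorphic (C D : category) (F G : functor C D) : Prop :=
  exists t : nat_trans F G, forall x, is_iso (t x).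

Definition is_equivalence (C D : category) (F : functor C D) : Prop :=
  exists G : functor D C,
    naturally_isomorphic (comp_functor G F) (id_functor C) /\
    naturally_isomorphic (comp_functor F G) (id_functor D).

Definition reflects_isos (C D : category) (F : functor C D) : Prop :=
  forall (x y : C) (f : hom x y), is_iso (fmap F f) -> is_iso f.

(** * Limits and colimits *)

Definition finite (T : Type) : Prop := exists l : list T, forall x, In x l.

Definition finite_category (J : category) : Prop :=
  finite J /\ forall x y : J, finite (hom x y).

Record cone (J C : category) (D : functor J C) := Cone {
  apex : C;
  leg : forall j, hom apex (D j);
  leg_nat : forall (i j : J) (f : hom i j), fmap D f ∘ leg i = leg j
}.

Definition is_limit (J C : category) (D : functor J C) (c : cone D) : Prop :=
  forall c' : cone D, exists! u : hom (apex c') (apex c),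
    forall j, leg c j ∘ u = leg c' j.

Definition has_finite_limits (C : category) : Prop :=
  forall (J : category) (D : functor J C), finite_category J ->
    exists c : cone D, is_limit c.

Definition is_initial (C : category) (z : C) : Prop :=
  forall x : C, exists! u : hom z x, True.

Definition is_terminal (C : category) (z : C) : Prop :=
  forall x : C, exists! u : hom x z, True.

Definition is_zero_object (C : category) (z : C) : Prop :=
  is_initial z /\ is_terminal z.

Definition is_coproduct (C : category) (I : Type) (x : I -> C)
    (s : C) (inj : forall i, hom (x i) s) : Prop :=
  forall (t : C) (f : forall i, hom (x i) t),
    exists! u : hom s t, forall i, u ∘ inj i = f i.

Definition has_finite_coproducts (C : category) : Prop :=
  forall (I : Type) (x : I -> C), finite I ->
    exists (s : C) (inj : forall i, hom (x i) s), is_coproduct inj.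

Definition is_binary_coproduct (C : category) (x y s : C)
    (i : hom x s) (j : hom y s) : Prop :=
  forall (t : C) (f : hom x t) (g : hom y t),
    exists! u : hom s t, u ∘ i = f /\ u ∘ j = g.

Definition is_pullback (C : category) (x y z p : C)
    (f : hom x z) (g : hom y z) (p1 : hom p x) (p2 : hom p y) : Prop :=
  f ∘ p1 = g ∘ p2 /\
  forall (t : C) (h : hom t x) (k : hom t y), f ∘ h = g ∘ k ->
    exists! u : hom t p, p1 ∘ u = h /\ p2 ∘ u = k.

Definition is_coequalizer (C : category) (x y q : C)
    (f g : hom x y) (e : hom y q) : Prop :=
  e ∘ f = e ∘ g /\
  forall (t : C) (h : hom y t), h ∘ f = h ∘ g ->
    exists! u : hom q t, u ∘ e = h.

(** * Classes of morphisms *)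

Definition is_mono (C : category) (x y : C) (m : hom x y) : Prop :=
  forall (t : C) (f g : hom t x), m ∘ f = m ∘ g -> f = g.

Definition is_epi (C : category) (x y : C) (e : hom x y) : Prop :=
  forall (t : C) (f g : hom y t), f ∘ e = g ∘ e -> f = g.

Definition is_strong_epi (C : category) (x y : C) (e : hom x y) : Prop :=
  is_epi e /\
  forall (a b : C) (m : hom a b), is_mono m ->
  forall (u : hom x a) (v : hom y b), m ∘ u = v ∘ e ->
    exists! d : hom y a, d ∘ e = u /\ m ∘ d = v.

Definition is_regular_epi (C : category) (x y : C) (e : hom x y) : Prop :=
  exists (w : C) (f g : hom w x), is_coequalizer f g e.

Definition is_kernel_pair (C : category) (x y r : C)
    (f : hom x y) (r1 r2 : hom r x) : Prop :=
  is_pullback f f r1 r2.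

Definition is_zero_morphism (C : category) (x y : C) (f : hom x y) : Prop :=
  exists (z : C) (u : hom x z) (v : hom z y), is_zero_object z /\ f = v ∘ u.

Definition is_kernel (C : category) (k x y : C) (f : hom x y) (n : hom k x) : Prop :=
  is_zero_morphism (f ∘ n) /\
  forall (t : C) (h : hom t x), is_zero_morphism (f ∘ h) ->
    exists! u : hom t k, n ∘ u = h.

(** * Internal relations *)

Record span (C : category) (y : C) := Span {
  sp_ob : C;
  sp_fst : hom sp_ob y;
  sp_snd : hom sp_ob y
}.

Definition map_span (C D : category) (F : functor C D) (y : C) (r : span y) :
  span (F y) := Span (fmap F (sp_fst r)) (fmap F (sp_snd r)).

Definition span_incl (C : category) (y : C) (r s : span y) : Prop :=
  exists h : hom (sp_ob r) (sp_ob s),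
    sp_fst s ∘ h = sp_fst r /\ sp_snd s ∘ h = sp_snd r.

Definition span_iso (C : category) (y : C) (r s : span y) : Prop :=
  exists h : hom (sp_ob r) (sp_ob s), is_iso h /\
    sp_fst s ∘ h = sp_fst r /\ sp_snd s ∘ h = sp_snd r.

Definition jointly_monic (C : category) (y : C) (r : span y) : Prop :=
  forall (t : C) (f g : hom t (sp_ob r)),
    sp_fst r ∘ f = sp_fst r ∘ g -> sp_snd r ∘ f = sp_snd r ∘ g -> f = g.

Definition reflexive (C : category) (y : C) (r : span y) : Prop :=
  exists e : hom y (sp_ob r), sp_fst r ∘ e = idm y /\ sp_snd r ∘ e = idm y.

Definition symmetric (C : category) (y : C) (r : span y) : Prop :=
  exists s : hom (sp_ob r) (sp_ob r),
    sp_fst r ∘ s = sp_snd r /\ sp_snd r ∘ s = sp_fst r.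

Definition transitive (C : category) (y : C) (r : span y) : Prop :=
  forall (p : C) (p1 p2 : hom p (sp_ob r)),
    is_pullback (sp_snd r) (sp_fst r) p1 p2 ->
    exists t : hom p (sp_ob r),
      sp_fst r ∘ t = sp_fst r ∘ p1 /\ sp_snd r ∘ t = sp_snd r ∘ p2.

Definition is_reflexive_relation (C : category) (y : C) (r : span y) : Prop :=
  jointly_monic r /\ reflexive r.

Definition is_equivalence_relation (C : category) (y : C) (r : span y) : Prop :=
  jointly_monic r /\ reflexive r /\ symmetric r /\ transitive r.

Definition is_effective (C : category) (y : C) (r : span y) : Prop :=
  exists (z : C) (f : hom y z), is_kernel_pair f (sp_fst r) (sp_snd r).

(** * Barr exact categories *)

Definition is_regular (C : category) : Prop :=
  has_finite_limits C /\
  (forall (x y r : C) (f : hom x y) (r1 r2 : hom r x), is_kernel_pair f r1 r2 ->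
     exists (q : C) (e : hom x q), is_coequalizer r1 r2 e) /\
  (forall (x y z p : C) (f : hom x z) (g : hom y z) (p1 : hom p x) (p2 : hom p y),
     is_pullback f g p1 p2 -> is_regular_epi f -> is_regular_epi p2).

Definition barr_exact (C : category) : Prop :=
  is_regular C /\
  forall (y : C) (r : span y), is_equivalence_relation r -> is_effective r.

(** * Points and Bourn protomodularity *)

Record point (C : category) (b : C) := Point {
  pt_ob : C;
  pt_proj : hom pt_ob b;
  pt_sect : hom b pt_ob;
  pt_split : pt_proj ∘ pt_sect = idm b
}.

Record point_hom (C : category) (b : C) (p q : point b) := PointHom {
  ph_mor : hom (pt_ob p) (pt_ob q);
  ph_proj : pt_proj q ∘ ph_mor = pt_proj p;
  ph_sect : ph_mor ∘ pt_sect p = pt_sect q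
}.

Lemma point_hom_eq (C : category) (b : C) (p q : point b) (f g : point_hom p q) :
  ph_mor f = ph_mor g -> f = g.
Proof.
  destruct f as [f f1 f2], g as [g g1 g2]; simpl; intros E; subst g.
  f_equal; apply proof_irrelevance.
Qed.

Definition point_idm (C : category) (b : C) (p : point b) : point_hom p p :=
  @PointHom C b p p (idm _) (comp_idr _) (comp_idl _).

Definition point_comp (C : category) (b : C) (p q r : point b)
  (g : point_hom q r) (f : point_hom p q) : point_hom p r.
Proof.
  refine (@PointHom C b p r (ph_mor g ∘ ph_mor f) _ _).
  - rewrite comp_assoc, (ph_proj g); apply ph_proj.
  - rewrite <- comp_assoc, (ph_sect f); apply ph_sect.
Defined.

Definition points (C : category) (b : C) : category.
Proof.
  refine (@Category (point b) (@point_hom C b) (@point_idm C b)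
            (@point_comp C b) _ _ _);
    intros; apply point_hom_eq; simpl.
  - apply comp_idl.
  - apply comp_idr.
  - apply comp_assoc.
Defined.

Record chosen_pullback (C : category) (x y z : C) (f : hom x z) (g : hom y z) :=
  ChosenPullback {
  pb_ob : C;
  pb_fst : hom pb_ob x;
  pb_snd : hom pb_ob y;
  pb_spec : is_pullback f g pb_fst pb_snd;
  pb_pair : forall (t : C) (h : hom t x) (k : hom t y), f ∘ h = g ∘ k -> hom t pb_ob;
  pb_pair_fst : forall t (h : hom t x) (k : hom t y) (E : f ∘ h = g ∘ k),
    pb_fst ∘ pb_pair E = h;
  pb_pair_snd : forall t (h : hom t x) (k : hom t y) (E : f ∘ h = g ∘ k),
    pb_snd ∘ pb_pair E = k
}.

Definition pullback_choice (C : category) : Type :=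
  forall (x y z : C) (f : hom x z) (g : hom y z), chosen_pullback f g.

Lemma pb_ext (C : category) (x y z : C) (f : hom x z) (g : hom y z)
    (P : chosen_pullback f g) (t : C) (h k : hom t (pb_ob P)) :
  pb_fst P ∘ h = pb_fst P ∘ k -> pb_snd P ∘ h = pb_snd P ∘ k -> h = k.
Proof.
  intros E1 E2; destruct (pb_spec P) as [sq univ].
  destruct (univ t (pb_fst P ∘ k) (pb_snd P ∘ k)) as [u [_ uniq]].
  - rewrite !comp_assoc, sq; reflexivity.
  - rewrite <- (uniq h (conj E1 E2)); apply uniq; split; reflexivity.
Qed.

Section PullbackFunctor.
Variables (C : category) (P : pullback_choice C) (b' b : C) (v : hom b' b).

Lemma pullback_sect_eq (p : point b) :
  pt_proj p ∘ (pt_sect p ∘ v) = v ∘ idm b'.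
Proof. rewrite comp_assoc, pt_split, comp_idl, comp_idr; reflexivity. Qed.

Definition pullback_point (p : point b) : point b' :=
  @Point C b' (pb_ob (P (pt_proj p) v)) (pb_snd (P (pt_proj p) v))
    (pb_pair (P (pt_proj p) v) (pullback_sect_eq p))
    (pb_pair_snd (P (pt_proj p) v) (pullback_sect_eq p)).

Lemma pullback_mor_eq (p q : point b) (f : point_hom p q) :
  pt_proj q ∘ (ph_mor f ∘ pb_fst (P (pt_proj p) v)) =
  v ∘ pb_snd (P (pt_proj p) v).
Proof. rewrite comp_assoc, ph_proj; exact (proj1 (pb_spec _)). Qed.

Definition pullback_point_hom (p q : point b) (f : point_hom p q) :
  point_hom (pullback_point p) (pullback_point q).
Proof.
  refine (@PointHom C b' (pullback_point p) (pullback_point q)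
            (pb_pair (P (pt_proj q) v) (pullback_mor_eq f)) _ _); simpl.
  - apply pb_pair_snd.
  - apply pb_ext; rewrite comp_assoc.
    + rewrite !pb_pair_fst, <- comp_assoc, pb_pair_fst, comp_assoc, ph_sect.
      reflexivity.
    + rewrite !pb_pair_snd; reflexivity.
Defined.

Definition pullback_functor : functor (points b) (points b').
Proof.
  refine (@Functor (points b) (points b') pullback_point pullback_point_hom _ _).
  - intros p; apply point_hom_eq; simpl; apply pb_ext.
    + rewrite pb_pair_fst, comp_idl, comp_idr; reflexivity.
    + rewrite pb_pair_snd, comp_idr; reflexivity.
  - intros p q r g f; apply point_hom_eq; simpl; apply pb_ext.
    + transitivity ((ph_mor g ∘ ph_mor f) ∘ pb_fst (P (pt_proj p) v)).
      * exact (pb_pair_fst _ _).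
      * rewrite comp_assoc, pb_pair_fst, <- !comp_assoc.
        rewrite pb_pair_fst; reflexivity.
    + rewrite pb_pair_snd, comp_assoc, !pb_pair_snd; reflexivity.
Defined.

End PullbackFunctor.

(** The pullback functors are determined by the choice of pullbacks up to natural
    isomorphism, so the choice is immaterial. *)
Definition protomodular (C : category) : Prop :=
  exists P : pullback_choice C,
    forall (b' b : C) (v : hom b' b), reflects_isos (pullback_functor P v).

Definition semi_abelian (C : category) : Prop :=
  (exists z : C, is_zero_object z) /\ barr_exact C /\ protomodular C /\
  has_finite_coproducts C.

Definition ideally_exact (C : category) : Prop :=
  barr_exact C /\ protomodular C /\ has_finite_coproducts C /\
  forall (i t : C) (f : hom i t),
    is_initial i -> is_terminal t -> is_regular_epi f.

(** * Monads and monadic functors *)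

Record monad (X : category) := Monad {
  m_functor :> functor X X;
  m_unit : nat_trans (id_functor X) m_functor;
  m_mult : nat_trans (comp_functor m_functor m_functor) m_functor;
  m_unit_l : forall x, m_mult x ∘ m_unit (m_functor x) = idm (m_functor x);
  m_unit_r : forall x, m_mult x ∘ fmap m_functor (m_unit x) = idm (m_functor x);
  m_assoc : forall x,
    m_mult x ∘ m_mult (m_functor x) = m_mult x ∘ fmap m_functor (m_mult x)
}.

Record algebra (X : category) (T : monad X) := Algebra {
  alg_ob : X;
  alg_act : hom (T alg_ob) alg_ob;
  alg_unit : alg_act ∘ m_unit T alg_ob = idm alg_ob;
  alg_mult : alg_act ∘ m_mult T alg_ob = alg_act ∘ fmap T alg_act
}.

Record algebra_hom (X : category) (T : monad X) (a b : algebra T) := AlgebraHom {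
  ah_mor : hom (alg_ob a) (alg_ob b);
  ah_act : ah_mor ∘ alg_act a = alg_act b ∘ fmap T ah_mor
}.

Lemma algebra_hom_eq (X : category) (T : monad X) (a b : algebra T)
    (f g : algebra_hom a b) : ah_mor f = ah_mor g -> f = g.
Proof.
  destruct f as [f f1], g as [g g1]; simpl; intros E; subst g.
  f_equal; apply proof_irrelevance.
Qed.

Definition algebra_idm (X : category) (T : monad X) (a : algebra T) :
  algebra_hom a a.
Proof.
  refine (@AlgebraHom X T a a (idm _) _).
  rewrite (fmap_id T), comp_idl, comp_idr; reflexivity.
Defined.

Definition algebra_comp (X : category) (T : monad X) (a b c : algebra T)
  (g : algebra_hom b c) (f : algebra_hom a b) : algebra_hom a c.
Proof.
  refine (@AlgebraHom X T a c (ah_mor g ∘ ah_mor f) _).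
  rewrite (fmap_comp T), <- comp_assoc, (ah_act f), !comp_assoc, (ah_act g).
  reflexivity.
Defined.

Definition algebras (X : category) (T : monad X) : category.
Proof.
  refine (@Category (algebra T) (@algebra_hom X T) (@algebra_idm X T)
            (@algebra_comp X T) _ _ _);
    intros; apply algebra_hom_eq; simpl.
  - apply comp_idl.
  - apply comp_idr.
  - apply comp_assoc.
Defined.

Record left_adjoint (A X : category) (U : functor A X) := LeftAdjoint {
  la_functor :> functor X A;
  la_unit : nat_trans (id_functor X) (comp_functor U la_functor);
  la_counit : nat_trans (comp_functor la_functor U) (id_functor A);
  la_triangle_l : forall x : X,
    la_counit (la_functor x) ∘ fmap la_functor (la_unit x) = idm (la_functor x);
  la_triangle_r : forall a : A, fmap U (la_counit a) ∘ la_unit (U a) = idm (U a)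
}.

Section Comparison.
Variables (A X : category) (U : functor A X) (F : left_adjoint U).

Definition induced_mult :
  nat_trans (comp_functor (comp_functor U F) (comp_functor U F))
            (comp_functor U F).
Proof.
  refine (@NatTrans _ _
            (comp_functor (comp_functor U F) (comp_functor U F))
            (comp_functor U F)
            (fun x => fmap U (la_counit F (F x))) _).
  intros x y f; simpl; rewrite <- !(fmap_comp U).
  f_equal; exact (naturality (la_counit F) (fmap F f)).
Defined.

Definition induced_monad : monad X.
Proof.
  refine (@Monad X (comp_functor U F) (la_unit F) induced_mult _ _ _);
    intros x; simpl.
  - apply la_triangle_r.
  - rewrite <- (fmap_comp U).
    exact (eq_trans (f_equal (fmap U) (la_triangle_l F x)) (fmap_id U (F x))).
  - rewrite <- !(fmap_comp U); f_equal.
    exact (eq_sym (naturality (la_counit F) (la_counit F (F x)))).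
Defined.

Definition comparison_ob (a : A) : algebra induced_monad.
Proof.
  refine (@Algebra X induced_monad (U a) (fmap U (la_counit F a)) _ _); simpl.
  - apply la_triangle_r.
  - rewrite <- !(fmap_comp U); f_equal.
    exact (eq_sym (naturality (la_counit F) (la_counit F a))).
Defined.

Definition comparison_hom (a b : A) (f : hom a b) :
  algebra_hom (comparison_ob a) (comparison_ob b).
Proof.
  refine (@AlgebraHom X induced_monad (comparison_ob a) (comparison_ob b)
            (fmap U f) _); simpl.
  rewrite <- !(fmap_comp U); f_equal.
  exact (eq_sym (naturality (la_counit F) f)).
Defined.

Definition comparison : functor A (algebras induced_monad).
Proof.
  refine (@Functor A (algebras induced_monad) comparison_ob comparison_hom _ _);
    intros; apply algebra_hom_eq; simpl.
  - apply fmap_id.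
  - apply fmap_comp.
Defined.

End Comparison.

(** [U] is monadic, witnessed by the left adjoint [F]. *)
Definition monadic (A X : category) (U : functor A X) (F : left_adjoint U) : Prop :=
  is_equivalence (comparison F).

Definition preserves_pullbacks (C D : category) (T : functor C D) : Prop :=
  forall (x y z p : C) (f : hom x z) (g : hom y z) (p1 : hom p x) (p2 : hom p y),
    is_pullback f g p1 p2 ->
    is_pullback (fmap T f) (fmap T g) (fmap T p1) (fmap T p2).

Definition preserves_kernel_pairs (C D : category) (T : functor C D) : Prop :=
  forall (x y r : C) (f : hom x y) (r1 r2 : hom r x),
    is_kernel_pair f r1 r2 ->
    is_kernel_pair (fmap T f) (fmap T r1) (fmap T r2).

Definition preserves_regular_epis (C D : category) (T : functor C D) : Prop :=
  forall (x y : C) (e : hom x y), is_regular_epi e -> is_regular_epi (fmap T e).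

Definition cartesian_nat_trans (C D : category) (F G : functor C D)
    (t : nat_trans F G) : Prop :=
  forall (x y : C) (f : hom x y), is_pullback (fmap G f) (t y) (t x) (fmap F f).

Definition cartesian_monad (X : category) (T : monad X) : Prop :=
  preserves_pullbacks T /\
  cartesian_nat_trans (m_unit T) /\ cartesian_nat_trans (m_mult T).

(** [s] is a coproduct [T z + x] of [T z] and [x], with [z] initial, and [c] is the
    comparison morphism [[T (!x), eta x]]. *)
Definition essentially_nullary (X : category) (T : monad X) : Prop :=
  forall (z x s : X) (i : hom (T z) s) (j : hom x s) (b : hom z x) (c : hom s (T x)),
    is_initial z -> is_binary_coproduct i j ->
    c ∘ i = fmap T b -> c ∘ j = m_unit T x ->
    is_strong_epi c.

(** * Ordered collections of isomorphism classes *)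

Record presentation := Presentation {
  rep :> Type;
  rep_iso : rep -> rep -> Prop;
  rep_le : rep -> rep -> Prop
}.

Definition iso_class (P : presentation) : Type :=
  { S : P -> Prop | exists x, forall y, S y <-> rep_iso x y }.

Definition class_of (P : presentation) (x : P) : iso_class P :=
  exist _ (rep_iso x) (ex_intro _ x (fun y => iff_refl _)).

Definition class_le (P : presentation) (S S' : iso_class P) : Prop :=
  forall x y : P, proj1_sig S x -> proj1_sig S' y -> rep_le x y.

Record is_lattice (T : Type) (le : T -> T -> Prop) : Prop := IsLattice {
  lat_refl : forall x, le x x;
  lat_antisym : forall x y, le x y -> le y x -> x = y;
  lat_trans : forall x y z, le x y -> le y z -> le x z;
  lat_meet : forall x y, exists m,
    le m x /\ le m y /\ forall z, le z x -> le z y -> le z m;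
  lat_join : forall x y, exists j,
    le x j /\ le y j /\ forall z, le x z -> le y z -> le j z
}.

Definition lattice_of_classes (P : presentation) : Prop := is_lattice (@class_le P).

(** The assignments below (kernel pair, kernel) are defined on representatives only
    up to isomorphism, hence are given by relations [r]; such an [r] is required to
    be everywhere defined and to induce an isomorphism of ordered collections [f]
    between the isomorphism classes. *)
Definition induces_order_iso (P Q : presentation) (r : P -> Q -> Prop) : Prop :=
  (forall x, exists y, r x y) /\
  exists (f : iso_class P -> iso_class Q) (g : iso_class Q -> iso_class P),
    (forall x y, r x y -> f (class_of x) = class_of y) /\
    (forall S, g (f S) = S) /\ (forall S, f (g S) = S) /\
    (forall S S', class_le S S' <-> class_le (f S) (f S')).

(** * Quotients, relations and normal subobjects of an object *)

Record quotient_map (C : category) (y : C) := QuotientMap {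
  qm_ob : C;
  qm_mor : hom y qm_ob;
  qm_regular : is_regular_epi qm_mor
}.

Definition Quot (C : category) (y : C) : presentation := {|
  rep := quotient_map y;
  rep_iso q q' := exists h : hom (qm_ob q) (qm_ob q'),
    is_iso h /\ h ∘ qm_mor q = qm_mor q';
  rep_le q q' := forall r r' : span y,
    is_kernel_pair (qm_mor q) (sp_fst r) (sp_snd r) ->
    is_kernel_pair (qm_mor q') (sp_fst r') (sp_snd r') ->
    span_incl r r'
|}.

Definition ERel (C : category) (y : C) : presentation := {|
  rep := { r : span y | is_equivalence_relation r };
  rep_iso r s := span_iso (proj1_sig r) (proj1_sig s);
  rep_le r s := span_incl (proj1_sig r) (proj1_sig s)
|}.

Definition RRel (C : category) (y : C) : presentation := {|
  rep := { r : span y | is_reflexive_relation r };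
  rep_iso r s := span_iso (proj1_sig r) (proj1_sig s);
  rep_le r s := span_incl (proj1_sig r) (proj1_sig s)
|}.

Record normal_mono (C : category) (y : C) := NormalMono {
  nm_ob : C;
  nm_mor : hom nm_ob y;
  nm_normal : exists (z : C) (f : hom y z), is_kernel f nm_mor
}.

Definition NSub (C : category) (y : C) : presentation := {|
  rep := normal_mono y;
  rep_iso n n' := exists h : hom (nm_ob n) (nm_ob n'),
    is_iso h /\ nm_mor n' ∘ h = nm_mor n;
  rep_le n n' := exists h : hom (nm_ob n) (nm_ob n'), nm_mor n' ∘ h = nm_mor n
|}.

Definition quot_erel (C : category) (y : C) (q : Quot y) (r : ERel y) : Prop :=
  is_kernel_pair (qm_mor q) (sp_fst (proj1_sig r)) (sp_snd (proj1_sig r)).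

Definition erel_rrel (C : category) (y : C) (r : ERel y) (s : RRel y) : Prop :=
  proj1_sig s = proj1_sig r.

Definition rrel_apply (A X : category) (U : functor A X) (a : A)
    (r : RRel a) (s : RRel (U a)) : Prop :=
  proj1_sig s = map_span U (proj1_sig r).

Definition quot_nsub (C : category) (y : C) (q : Quot y) (n : NSub y) : Prop :=
  is_kernel (qm_mor q) (nm_mor n).

Record lattices_canonically_isomorphic (A X : category) (U : functor A X) (a : A) :
  Prop := LatticesCanonicallyIsomorphic {
  lat_quot : lattice_of_classes (Quot a);
  lat_erel : lattice_of_classes (ERel a);
  lat_rrel : lattice_of_classes (RRel a);
  lat_rrel_U : lattice_of_classes (RRel (U a));
  lat_erel_U : lattice_of_classes (ERel (U a));
  lat_quot_U : lattice_of_classes (Quot (U a));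
  lat_nsub_U : lattice_of_classes (NSub (U a));
  iso_quot_erel : induces_order_iso (@quot_erel A a);
  iso_erel_rrel : induces_order_iso (@erel_rrel A a);
  iso_rrel_rrel_U : induces_order_iso (@rrel_apply A X U a);
  iso_erel_rrel_U : induces_order_iso (@erel_rrel X (U a));
  iso_quot_erel_U : induces_order_iso (@quot_erel X (U a));
  iso_quot_nsub_U : induces_order_iso (@quot_nsub X (U a))
}.

Definition ideal_monadic_functor (A X : category) (U : functor A X)
    (F : left_adjoint U) : Prop :=
  semi_abelian X /\ monadic F /\
  preserves_regular_epis (induced_monad F) /\
  preserves_kernel_pairs (induced_monad F) /\
  cartesian_monad (induced_monad F) /\
  essentially_nullary (induced_monad F).

(* Main.v *)
From Stdlib Require Import List Classical ProofIrrelevance FunctionalExtensionality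
  PropExtensionality IndefiniteDescription.
Require Import Defs.

Set Implicit Arguments.
Unset Strict Implicit.
Unset Printing Implicit Defensive.
Local Open Scope cat_scope.

(** A relation on an object is handled here through its generalized elements: for
    [a b : t -> y], [related r a b] says that [(a, b)] factors through [r]. Relations
    can then be manipulated as in sets, and the seven collections are compared by six
    relations between representatives, each shown to preserve and reflect the order and
    to be onto up to isomorphism ([correspondence]).

    In an exact category quotients correspond to equivalence relations
    ([quot_erel_correspondence]): a regular epimorphism is the coequalizer of its kernel
    pair, and the coequalizer of an effective relation has that relation as its kernel
    pair. In a pointed protomodular category a regular epimorphism is moreover the
    cokernel of its kernel, so that quotients correspond to normal subobjects
    ([quot_nsub_correspondence]). Protomodularity also makes every reflexive relation an
    equivalence relation ([protomodular_maltsev]). Both facts come from one principle,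
    [section_and_fibre_extremal]: a subobject of a split epimorphism containing the
    section and one fibre is everything.

    The bridge between [A] and [X] is that for an essentially nullary monad every
    reflexive relation [R] on the carrier of an algebra is a subalgebra
    ([reflexive_relation_subalgebra]): [T R] is covered by [T 0 + R], and on constants
    the two projections of [R] agree, so constants land in the diagonal. By monadicity
    such an [R] lifts to [A] ([rrel_apply_correspondence]), and symmetry and
    transitivity descend from [X] to [A] ([monadic_maltsev]). Binary meets and joins are
    built once, for reflexive relations on [U a], where the join of two relations is
    their composite, and are carried to the other collections along the
    correspondences.

    For an ideally exact category with initial object [0], the category [X] is the slice
    over [0] and [U a = a * 0], right adjoint to the forgetful functor. The slice
    inherits exactness, protomodularity and coproducts, and is pointed because [0] is
    initial. The monad is [x |-> x * 0]; it is cartesian, and preserves regular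
    epimorphisms because these are stable under pullback, and it is essentially nullary
    because [x * 0], as a point over [x], has [0 * 0] as the fibre over [0]
    ([product_monad_essentially_nullary]). Monadicity ([product_functor_monadic]) is
    descent along [0 -> 1], a regular epimorphism by assumption: an algebra structure on
    [x] is an effective equivalence relation on [x], whose quotient is the descended
    object. *)

(** * Equational reasoning and generalized elements *)

Lemma precomp (C : category) (x y z : C) (g : hom y z) (f : hom x y) (k : hom x z) :
  g ∘ f = k -> forall (w : C) (u : hom w x), g ∘ (f ∘ u) = k ∘ u.
Proof. intros E w u; rewrite comp_assoc, E; reflexivity. Qed.

(* Rewrites with an equation between composites anywhere in a composite, after
   bracketing to the right. *)
Ltac crw E :=
  rewrite <- ?comp_assoc; first [rewrite E | rewrite (precomp E)];
  rewrite <- ?comp_assoc, ?comp_idl, ?comp_idr.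

Lemma exists_unique_eq (T : Type) (P : T -> Prop) (a b : T) :
  (exists! u, P u) -> P a -> P b -> a = b.
Proof. intros [u [_ uniq]] Ha Hb; rewrite <- (uniq a Ha); exact (uniq b Hb). Qed.

Lemma pullback_eq (C : category) (x y z p : C) (f : hom x z) (g : hom y z)
    (p1 : hom p x) (p2 : hom p y) (t : C) (u v : hom t p) :
  is_pullback f g p1 p2 -> p1 ∘ u = p1 ∘ v -> p2 ∘ u = p2 ∘ v -> u = v.
Proof.
  intros [sq univ] E1 E2.
  apply (exists_unique_eq (P := fun w => p1 ∘ w = p1 ∘ v /\ p2 ∘ w = p2 ∘ v)
           (a := u) (b := v)); auto.
  apply univ; rewrite !comp_assoc, sq; reflexivity.
Qed.

(** Membership of a pair of generalized elements. For the generic pair of projections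
    it is inclusion of spans, so universally quantified implications between such
    memberships capture inclusion, symmetry and transitivity. *)
Definition related (C : category) (y : C) (r : span y) (t : C) (a b : hom t y) : Prop :=
  exists c : hom t (sp_ob r), sp_fst r ∘ c = a /\ sp_snd r ∘ c = b.

Lemma related_precomp (C : category) (y : C) (r : span y) (t t' : C) (a b : hom t y)
    (u : hom t' t) : related r a b -> related r (a ∘ u) (b ∘ u).
Proof.
  intros [c [<- <-]]; exists (c ∘ u); rewrite !comp_assoc; auto.
Qed.

Lemma related_proj (C : category) (y : C) (r : span y) :
  related r (sp_fst r) (sp_snd r).
Proof. exists (idm _); rewrite !comp_idr; auto. Qed.

Lemma span_incl_related (C : category) (y : C) (r s : span y) :
  span_incl r s <-> forall (t : C) (a b : hom t y), related r a b -> related s a b.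
Proof.
  split.
  - intros [h [E1 E2]] t a b [c [<- <-]]; exists (h ∘ c).
    rewrite !comp_assoc, E1, E2; auto.
  - intros H; exact (H _ _ _ (related_proj r)).
Qed.

Lemma reflexive_related (C : category) (y : C) (r : span y) (t : C) (a : hom t y) :
  reflexive r -> related r a a.
Proof.
  intros [e [E1 E2]]; exists (e ∘ a); rewrite !comp_assoc, E1, E2, comp_idl; auto.
Qed.

Lemma symmetric_related (C : category) (y : C) (r : span y) :
  symmetric r <-> forall (t : C) (a b : hom t y), related r a b -> related r b a.
Proof.
  split.
  - intros [s [E1 E2]] t a b [c [<- <-]]; exists (s ∘ c).
    rewrite !comp_assoc, E1, E2; auto.
  - intros H; exact (H _ _ _ (related_proj r)).
Qed.

Definition has_pullbacks (C : category) : Prop :=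
  forall (x y z : C) (f : hom x z) (g : hom y z),
    exists (p : C) (p1 : hom p x) (p2 : hom p y), is_pullback f g p1 p2.

Lemma transitive_related (C : category) (y : C) (r : span y) :
  has_pullbacks C -> transitive r ->
  forall (t : C) (a b c : hom t y), related r a b -> related r b c -> related r a c.
Proof.
  intros pbs tr t a b c [u [<- <-]] [v [E <-]].
  destruct (pbs _ _ _ (sp_snd r) (sp_fst r)) as (p & p1 & p2 & pb).
  destruct (tr _ _ _ pb) as (d & D1 & D2).
  destruct (proj2 pb _ u v (eq_sym E)) as (w & [W1 W2] & _).
  exists (d ∘ w); rewrite !comp_assoc, D1, D2, <- !comp_assoc, W1, W2; auto.
Qed.

Lemma related_transitive (C : category) (y : C) (r : span y) :
  (forall (t : C) (a b c : hom t y), related r a b -> related r b c -> related r a c) ->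
  transitive r.
Proof.
  intros H p p1 p2 [sq _].
  destruct (H p (sp_fst r ∘ p1) (sp_snd r ∘ p1) (sp_snd r ∘ p2)) as (c & E1 & E2).
  - exists p1; auto.
  - exists p2; auto.
  - exists c; auto.
Qed.

(** * Finite limits and slice categories *)

Definition is_product (C : category) (x y p : C) (p1 : hom p x) (p2 : hom p y) : Prop :=
  forall (t : C) (f : hom t x) (g : hom t y), exists! u : hom t p, p1 ∘ u = f /\ p2 ∘ u = g.

Definition has_products (C : category) : Prop :=
  forall x y : C, exists (p : C) (p1 : hom p x) (p2 : hom p y), is_product p1 p2.

Lemma product_eq (C : category) (x y p t : C) (p1 : hom p x) (p2 : hom p y)
    (u v : hom t p) :
  is_product p1 p2 -> p1 ∘ u = p1 ∘ v -> p2 ∘ u = p2 ∘ v -> u = v.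
Proof.
  intros H E1 E2.
  apply (exists_unique_eq (P := fun w => p1 ∘ w = p1 ∘ v /\ p2 ∘ w = p2 ∘ v)
           (a := u) (b := v)); auto.
Qed.

Definition discrete (I : Type) : category.
Proof.
  refine (@Category I (fun i j => i = j) (fun i => eq_refl)
            (fun x y z g f => eq_trans f g) _ _ _);
    intros; apply proof_irrelevance.
Defined.

Lemma discrete_finite (I : Type) : finite I -> finite_category (discrete I).
Proof.
  intros fin; split; [exact fin|].
  intros i j; simpl.
  destruct (classic (i = j)) as [E | E].
  - exists (E :: nil); intros E'; left; apply proof_irrelevance.
  - exists nil; intros E'; contradiction.
Qed.

Definition discrete_diagram (C : category) (I : Type) (x : I -> C) :
  functor (discrete I) C.
Proof.
  refine (@Functor (discrete I) C x
            (fun i j (e : i = j) => match e with eq_refl => idm (x i) end) _ _).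
  - reflexivity.
  - intros i j k g f; simpl in f, g; destruct f, g; simpl.
    symmetry; apply comp_idl.
Defined.

Lemma finite_limits_terminal (C : category) :
  has_finite_limits C -> exists t : C, is_terminal t.
Proof.
  intros lim.
  destruct (lim (discrete Empty_set)
              (discrete_diagram (fun e : Empty_set => match e with end))) as [c H].
  { apply discrete_finite; exists nil; intros []. }
  exists (apex c); intros x.
  destruct (H (@Cone (discrete Empty_set) C _ x
    (fun j => match j with end) (fun j => match j with end))) as (u & _ & uniq).
  exists u; split; [exact I | intros v _; apply uniq; intros []].
Qed.

Lemma finite_limits_products (C : category) : has_finite_limits C -> has_products C.
Proof.
  intros lim x y.
  pose (D := discrete_diagram (fun b : bool => if b then x else y)).
  destruct (lim (discrete bool) D) as [c H].
  { apply discrete_finite; exists (true :: false :: nil); intros []; simpl; auto. }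
  exists (apex c), (leg c true), (leg c false).
  intros t f g.
  unshelve epose proof (H (@Cone (discrete bool) C D t
    (fun b => match b return hom t (D b) with true => f | false => g end) _)) as K.
  - intros i j e; simpl in e; destruct e; simpl; apply comp_idl.
  - destruct K as (u & E & uniq); exists u; split.
    + split; [exact (E true) | exact (E false)].
    + intros v [E1 E2]; apply uniq; intros []; assumption.
Qed.

Record slice_ob (C : category) (b : C) := SliceOb {
  so_ob : C;
  so_map : hom so_ob b
}.

Record slice_hom (C : category) (b : C) (x y : slice_ob b) := SliceHom {
  sh_mor : hom (so_ob x) (so_ob y);
  sh_map : so_map y ∘ sh_mor = so_map x
}.

Lemma slice_hom_eq (C : category) (b : C) (x y : slice_ob b) (f g : slice_hom x y) :
  sh_mor f = sh_mor g -> f = g.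
Proof.
  destruct f as [f Hf], g as [g Hg]; simpl; intros E; subst g.
  f_equal; apply proof_irrelevance.
Qed.

Definition slice_comp (C : category) (b : C) (x y z : slice_ob b)
  (g : slice_hom y z) (f : slice_hom x y) : slice_hom x z.
Proof.
  refine (@SliceHom C b x z (sh_mor g ∘ sh_mor f) _).
  rewrite comp_assoc, (sh_map g); apply sh_map.
Defined.

Definition slice (C : category) (b : C) : category.
Proof.
  refine (@Category (slice_ob b) (@slice_hom C b)
            (fun x => @SliceHom C b x x (idm _) (comp_idr _)) (@slice_comp C b) _ _ _);
    intros; apply slice_hom_eq; simpl.
  - apply comp_idl.
  - apply comp_idr.
  - apply comp_assoc.
Defined.

Definition slice_forget (C : category) (b : C) : functor (slice b) C.
Proof.
  refine (@Functor (slice b) C (@so_ob C b) (@sh_mor C b) _ _); reflexivity.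
Defined.

(** The shape of a diagram over [b]: the added terminal object is sent to [b] and the
    maps into it to the structure maps. *)
Definition with_terminal (J : category) : category.
Proof.
  refine (@Category (option J)
    (fun x y => match x, y with
                | Some i, Some j => hom i j
                | _, None => unit
                | None, Some _ => Empty_set
                end)
    (fun x => match x with Some i => idm i | None => tt end)
    (fun x y z => match x, y, z with
       | Some i, Some j, Some k => fun g f => g ∘ f
       | _, _, None => fun _ _ => tt
       | _, None, Some _ => fun g _ => match g with end
       | None, Some _, Some _ => fun _ f => match f with end
       end) _ _ _).
  - intros [i|] [j|] f; try destruct f; try reflexivity; apply comp_idl.
  - intros [i|] [j|] f; try destruct f; try reflexivity; apply comp_idr.
  - intros [i|] [j|] [k|] [l|] h g f;
      try destruct h; try destruct g; try destruct f; try reflexivity; apply comp_assoc.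
Defined.

Lemma with_terminal_finite (J : category) :
  finite_category J -> finite_category (with_terminal J).
Proof.
  intros [[l fl] fh]; split.
  - exists (None :: map Some l); intros [j|]; [right; apply in_map, fl | left; reflexivity].
  - intros [i|] [j|]; simpl.
    + apply fh.
    + exists (tt :: nil); intros []; left; reflexivity.
    + exists nil; intros [].
    + exists (tt :: nil); intros []; left; reflexivity.
Qed.

Definition slice_diagram (C : category) (b : C) (J : category)
  (D : functor J (slice b)) : functor (with_terminal J) C.
Proof.
  refine (@Functor (with_terminal J) C
    (fun x => match x with Some j => so_ob (D j) | None => b end)
    (fun x y => match x, y return
        @hom (with_terminal J) x y ->
        hom (match x with Some j => so_ob (D j) | None => b end)
            (match y with Some j => so_ob (D j) | None => b end) with
      | Some i, Some j => fun f => sh_mor (fmap D f)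
      | Some i, None => fun _ => so_map (D i)
      | None, Some _ => fun f => match f with end
      | None, None => fun _ => idm b
      end) _ _).
  - intros [j|]; simpl; [rewrite (fmap_id D)|]; reflexivity.
  - intros [i|] [j|] [k|] g f; simpl in f, g |- *;
      try destruct f; try destruct g; rewrite ?comp_idl; try reflexivity.
    + rewrite (fmap_comp D); reflexivity.
    + symmetry; apply sh_map.
Defined.

(** A limit over [b] is a limit of the diagram extended by its structure maps to
    [b]. *)
Lemma slice_finite_limits (C : category) (b : C) :
  has_finite_limits C -> has_finite_limits (slice b).
Proof.
  intros lim J D fin.
  destruct (lim _ (slice_diagram D) (with_terminal_finite fin)) as [c H].
  pose (a := @SliceOb C b (apex c) (leg c None)).
  unshelve eexists (@Cone J (slice b) D a
    (fun j => @SliceHom C b a (D j) (leg c (Some j)) _) _).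
  - exact (@leg_nat _ _ _ c (Some j) None tt).
  - intros i j f; apply slice_hom_eq; exact (@leg_nat _ _ _ c (Some i) (Some j) f).
  - intros c'.
    unshelve epose proof (H (@Cone _ _ (slice_diagram D) (so_ob (apex c'))
      (fun x => match x return hom _ (slice_diagram D x) with
                | Some j => sh_mor (leg c' j) | None => so_map (apex c') end) _)) as K.
    + intros [i|] [j|] f; simpl in f |- *; try destruct f.
      * rewrite <- (leg_nat c' f); reflexivity.
      * apply sh_map.
      * apply comp_idl.
    + destruct K as (u & E & uniq).
      unshelve eexists (@SliceHom C b (apex c') a u _).
      * exact (E None).
      * split.
        { intros j; apply slice_hom_eq; exact (E (Some j)). }
        intros v Hv; apply slice_hom_eq; simpl; apply uniq.
        intros [j|]; [exact (f_equal (@sh_mor _ _ _ _) (Hv j)) | exact (sh_map v)].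
Qed.

(** A pullback is a product in the slice over the common codomain. *)
Lemma finite_limits_pullbacks (C : category) : has_finite_limits C -> has_pullbacks C.
Proof.
  intros lim x y z f g.
  destruct (finite_limits_products (slice_finite_limits (b := z) lim)
              (SliceOb f) (SliceOb g)) as (p & p1 & p2 & H).
  exists (so_ob p), (sh_mor p1), (sh_mor p2); split.
  - exact (eq_trans (sh_map p1) (eq_sym (sh_map p2))).
  - intros t h k E.
    destruct (H (SliceOb (f ∘ h)) (@SliceHom C z (SliceOb (f ∘ h)) (SliceOb f) h eq_refl)
                (@SliceHom C z (SliceOb (f ∘ h)) (SliceOb g) k (eq_sym E)))
      as (u & [E1 E2] & uniq).
    exists (sh_mor u); split.
    + split; [exact (f_equal (@sh_mor _ _ _ _) E1) | exact (f_equal (@sh_mor _ _ _ _) E2)].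
    + intros v [V1 V2].
      assert (Ev : so_map p ∘ v = f ∘ h).
      { rewrite <- V1, comp_assoc; f_equal; symmetry; exact (sh_map p1). }
      refine (f_equal (@sh_mor _ _ _ _) (uniq (@SliceHom C z (SliceOb (f ∘ h)) p v Ev) _)).
      split; apply slice_hom_eq; assumption.
Qed.

(** * Kernel pairs, regular epimorphisms and images *)

Lemma kernel_pair_related (C : category) (x y : C) (f : hom x y) (r : span x) :
  is_kernel_pair f (sp_fst r) (sp_snd r) ->
  forall (t : C) (a b : hom t x), related r a b <-> f ∘ a = f ∘ b.
Proof.
  intros [sq univ] t a b; split.
  - intros [c [<- <-]]; rewrite !comp_assoc, sq; reflexivity.
  - intros E; destruct (univ t a b E) as (c & H & _); exists c; exact H.
Qed.

Lemma kernel_pair_jointly_monic (C : category) (x y : C) (f : hom x y) (r : span x) :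
  is_kernel_pair f (sp_fst r) (sp_snd r) -> jointly_monic r.
Proof. intros H t a b E1 E2; exact (pullback_eq H E1 E2). Qed.

Lemma kernel_pair_intro (C : category) (x y : C) (f : hom x y) (r : span x) :
  jointly_monic r ->
  (forall (t : C) (a b : hom t x), related r a b <-> f ∘ a = f ∘ b) ->
  is_kernel_pair f (sp_fst r) (sp_snd r).
Proof.
  intros jm H; split.
  - apply H, related_proj.
  - intros t a b E; destruct (proj2 (H t a b) E) as (c & E1 & E2).
    exists c; split; [auto|]; intros d [D1 D2]; apply jm; congruence.
Qed.

Lemma kernel_pair_equivalence (C : category) (x y : C) (f : hom x y) (r : span x) :
  is_kernel_pair f (sp_fst r) (sp_snd r) -> is_equivalence_relation r.
Proof.
  intros H; pose proof (kernel_pair_related H) as K.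
  split; [exact (kernel_pair_jointly_monic H)|]; split; [|split].
  - apply (K x (idm x) (idm x)); reflexivity.
  - apply symmetric_related; intros t a b; rewrite !K; auto.
  - apply related_transitive; intros t a b c; rewrite !K; congruence.
Qed.

Lemma kernel_pair_exists (C : category) (x y : C) (f : hom x y) :
  has_pullbacks C -> exists r : span x, is_kernel_pair f (sp_fst r) (sp_snd r).
Proof.
  intros pbs; destruct (pbs _ _ _ f f) as (p & p1 & p2 & H).
  exists (Span p1 p2); exact H.
Qed.

Lemma regular_has_pullbacks (C : category) : is_regular C -> has_pullbacks C.
Proof. intros [lim _]; exact (finite_limits_pullbacks lim). Qed.

Lemma coequalizer_epi (C : category) (w x y : C) (f g : hom w x) (e : hom x y) :
  is_coequalizer f g e -> is_epi e.
Proof.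
  intros [sq univ] t a b E.
  apply (exists_unique_eq (P := fun u => u ∘ e = b ∘ e)); auto.
  apply univ; crw sq; reflexivity.
Qed.

Lemma regular_epi_epi (C : category) (x y : C) (e : hom x y) :
  is_regular_epi e -> is_epi e.
Proof. intros (w & f & g & H); exact (coequalizer_epi H). Qed.

Lemma regular_epi_coequalizer (C : category) (x y : C) (e : hom x y) (r : span x) :
  is_regular_epi e -> is_kernel_pair e (sp_fst r) (sp_snd r) ->
  is_coequalizer (sp_fst r) (sp_snd r) e.
Proof.
  intros (w & f & g & sq & univ) H; split; [exact (proj1 H)|].
  intros t h E; apply univ.
  destruct (proj2 (kernel_pair_related H f g) sq) as (c & <- & <-).
  crw E; reflexivity.
Qed.

Lemma regular_epi_orthogonal (C : category) (x y a b : C) (e : hom x y) (m : hom a b)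
    (u : hom x a) (v : hom y b) :
  is_regular_epi e -> is_mono m -> m ∘ u = v ∘ e ->
  exists d : hom y a, d ∘ e = u /\ m ∘ d = v.
Proof.
  intros He mono E; pose proof He as (w & f & g & sq & univ).
  destruct (univ a u) as (d & D & _).
  - apply mono; crw E; crw sq; crw E; reflexivity.
  - exists d; split; [exact D|].
    apply (regular_epi_epi He); crw D; exact E.
Qed.

Lemma mono_split_epi_iso (C : category) (x y : C) (m : hom x y) (d : hom y x) :
  is_mono m -> m ∘ d = idm y -> is_iso m.
Proof.
  intros mono E; exists d; split; [|exact E].
  apply mono; crw E; reflexivity.
Qed.

Lemma iso_mono (C : category) (x y : C) (f : hom x y) : is_iso f -> is_mono f.
Proof.
  intros (g & E & _) t a b H.
  rewrite <- (comp_idl a), <- (comp_idl b), <- E, <- !comp_assoc, H; reflexivity.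
Qed.

(** As [f] factors through the coequalizer [e], two elements identified by [e] are
    identified by [f]; conversely [e] coequalizes the kernel pair of [f]. *)
Lemma kernel_pair_coequalizer (C : category) (x y : C) (f : hom x y) (r : span x) :
  is_regular C -> is_kernel_pair f (sp_fst r) (sp_snd r) ->
  exists (q : C) (e : hom x q), is_regular_epi e /\
    is_kernel_pair e (sp_fst r) (sp_snd r) /\ exists m : hom q y, m ∘ e = f.
Proof.
  intros (_ & coeq & _) H.
  destruct (coeq _ _ _ _ _ _ H) as (q & e & He).
  destruct (proj2 He _ f (proj1 H)) as (m & Em & _).
  exists q, e; split; [eexists _, _, _; exact He|]; split; [|exists m; exact Em].
  apply kernel_pair_intro; [exact (kernel_pair_jointly_monic H)|].
  intros t a b; split.
  - intros [c [<- <-]]; rewrite !comp_assoc, (proj1 He); reflexivity.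
  - intros E; apply (kernel_pair_related H); rewrite <- Em; crw E; reflexivity.
Qed.

(** If [m a = m b], then after pulling back along regular epimorphisms [a] and [b]
    lift through [e] to a pair in the kernel pair of [f], which [e] identifies; so
    [m] is a monomorphism. *)
Lemma regular_image (C : category) (x y : C) (f : hom x y) :
  is_regular C ->
  exists (q : C) (e : hom x q) (m : hom q y), is_regular_epi e /\ is_mono m /\ m ∘ e = f.
Proof.
  intros reg; pose proof (regular_has_pullbacks reg) as pbs.
  destruct (kernel_pair_exists f pbs) as [r Hr].
  destruct (kernel_pair_coequalizer reg Hr) as (q & e & He & Ke & m & Em).
  exists q, e, m; split; [exact He|]; split; [|exact Em].
  intros t a b E.
  destruct reg as (_ & _ & stable).
  destruct (pbs _ _ _ e a) as (t1 & x1 & a1 & pb1).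
  destruct (pbs _ _ _ e (b ∘ a1)) as (t2 & x2 & a2 & pb2).
  apply (regular_epi_epi (stable _ _ _ _ _ _ _ _ pb1 He)).
  apply (regular_epi_epi (stable _ _ _ _ _ _ _ _ pb2 He)).
  rewrite <- (proj1 pb1), <- (proj1 pb2), <- comp_assoc.
  apply (kernel_pair_related Ke), (kernel_pair_related Hr).
  rewrite <- Em; crw (proj1 pb1); crw (proj1 pb2); crw E; reflexivity.
Qed.

(** * Protomodularity *)

Lemma point_iso (C : category) (b : C) (p q : point b) (f : point_hom p q) :
  @is_iso (points b) p q f <-> is_iso (ph_mor f).
Proof.
  split.
  - intros (g & E1 & E2); exists (ph_mor g).
    split; [exact (f_equal (@ph_mor _ _ _ _) E1) | exact (f_equal (@ph_mor _ _ _ _) E2)].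
  - intros (g & E1 & E2).
    unshelve eexists (@PointHom C b q p g _ _).
    + rewrite <- (ph_proj f); crw E2; reflexivity.
    + rewrite <- (ph_sect f); crw E1; reflexivity.
    + split; apply point_hom_eq; assumption.
Qed.

(** [v^* f] is an isomorphism, expressed without chosen pullbacks: an element of the
    pullback of [q] along [v] is a pair [(a, k)] as below. *)
Definition iso_over (C : category) (b' b : C) (v : hom b' b) (p q : point b)
    (f : point_hom p q) : Prop :=
  forall (t : C) (a : hom t (pt_ob q)) (k : hom t b'), pt_proj q ∘ a = v ∘ k ->
    exists! c : hom t (pt_ob p), ph_mor f ∘ c = a.

Lemma iso_over_pullback (C : category) (P : pullback_choice C) (b' b : C)
    (v : hom b' b) (p q : point b) (f : point_hom p q) :
  is_iso (fmap (pullback_functor P v) f) <-> iso_over v f.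
Proof.
  set (Qp := P _ _ _ (pt_proj p) v); set (Qq := P _ _ _ (pt_proj q) v).
  rewrite point_iso; simpl; fold Qp Qq.
  set (g := pb_pair Qq (pullback_mor_eq P v f)).
  assert (G1 : pb_fst Qq ∘ g = ph_mor f ∘ pb_fst Qp) by apply pb_pair_fst.
  assert (G2 : pb_snd Qq ∘ g = pb_snd Qp) by apply pb_pair_snd.
  pose proof (proj1 (pb_spec Qp)) as Sp; pose proof (proj1 (pb_spec Qq)) as Sq.
  split.
  - intros (g' & E1 & E2) t a k E.
    exists (pb_fst Qp ∘ (g' ∘ pb_pair Qq E)); split.
    + crw (eq_sym G1); crw E2; apply pb_pair_fst.
    + intros c <-.
      assert (Ec : pt_proj p ∘ c = v ∘ k).
      { rewrite <- (ph_proj f), <- comp_assoc; exact E. }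
      assert (Eg : g ∘ pb_pair Qp Ec = pb_pair Qq E).
      { apply (pb_ext (P := Qq)).
        - crw G1; rewrite !pb_pair_fst; reflexivity.
        - crw G2; rewrite !pb_pair_snd; reflexivity. }
      rewrite <- Eg; crw E1; apply pb_pair_fst.
  - intros H.
    destruct (H _ _ _ Sq) as (c & Ec & _).
    assert (Sc : pt_proj p ∘ c = v ∘ pb_snd Qq).
    { rewrite <- (ph_proj f), <- comp_assoc, Ec; exact Sq. }
    exists (pb_pair Qp Sc); split; (apply (pb_ext (P := Qp)) || apply (pb_ext (P := Qq)));
      rewrite comp_assoc, ?pb_pair_fst, ?pb_pair_snd, ?G1, ?G2, ?comp_idr.
    + apply (exists_unique_eq (P := fun w => ph_mor f ∘ w = ph_mor f ∘ pb_fst Qp)); auto.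
      * apply (H _ _ (pb_snd Qp)); crw (ph_proj f); exact Sp.
      * crw Ec; exact G1.
    + reflexivity.
    + crw (pb_pair_fst Qp Sc); exact Ec.
    + reflexivity.
Qed.

Definition reflects_isos_over (C : category) : Prop :=
  forall (b' b : C) (v : hom b' b) (p q : point b) (f : point_hom p q),
    iso_over v f -> is_iso (ph_mor f).

Lemma protomodular_reflects_isos_over (C : category) :
  protomodular C -> reflects_isos_over C.
Proof.
  intros [P H] b' b v p q f Hf; apply point_iso, (H _ _ v).
  apply iso_over_pullback; exact Hf.
Qed.

Lemma reflects_isos_over_protomodular (C : category) (P : pullback_choice C) :
  reflects_isos_over C -> protomodular C.
Proof.
  intros H; exists P; intros b' b v p q f Hf; apply point_iso, (H _ _ v).
  apply iso_over_pullback in Hf; exact Hf.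
Qed.

(** Here [w] contains the section and the whole pullback of [x] along [v], so [m] is a
    morphism of points that [v^*] inverts. *)
Lemma section_and_fibre_extremal (C : category) (b' b x w : C) (v : hom b' b)
    (p : hom x b) (s : hom b x) (m : hom w x) :
  protomodular C -> p ∘ s = idm b -> is_mono m ->
  (exists s' : hom b w, m ∘ s' = s) ->
  (forall (t : C) (a : hom t x) (k : hom t b'), p ∘ a = v ∘ k ->
     exists c : hom t w, m ∘ c = a) ->
  is_iso m.
Proof.
  intros pm ps mono [s' Es] H.
  assert (ps' : (p ∘ m) ∘ s' = idm b) by (crw Es; exact ps).
  apply (protomodular_reflects_isos_over pm (v := v)
           (f := @PointHom C b (Point ps') (Point ps) m eq_refl Es)).
  intros t a k E; destruct (H t a k E) as [c Ec]; exists c; split; [exact Ec|].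
  intros d Ed; apply mono; simpl in *; congruence.
Qed.

(** The extent of a relation between two given maps, as the pullback of [r] along
    [(a, b)]. For the diagonal span it is their equalizer. *)
Lemma related_subobject (C : category) (y : C) (r : span y) (x : C) (a b : hom x y) :
  has_products C -> has_pullbacks C -> jointly_monic r ->
  exists (w : C) (m : hom w x), is_mono m /\
    forall (t : C) (u : hom t x),
      (exists c : hom t w, m ∘ c = u) <-> related r (a ∘ u) (b ∘ u).
Proof.
  intros prods pbs jm.
  destruct (prods y y) as (yy & p1 & p2 & prod).
  destruct (prod _ a b) as (ab & [A1 A2] & _).
  destruct (prod _ (sp_fst r) (sp_snd r)) as (i & [I1 I2] & _).
  destruct (pbs _ _ _ ab i) as (w & m & n & pb).
  exists w, m; split.
  - intros t f g E; apply (pullback_eq pb E), jm.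
    + rewrite <- I1; do 2 crw (eq_sym (proj1 pb)); rewrite E; reflexivity.
    + rewrite <- I2; do 2 crw (eq_sym (proj1 pb)); rewrite E; reflexivity.
  - intros t u; split.
    + intros [c <-]; exists (n ∘ c); rewrite <- I1, <- I2, <- A1, <- A2.
      split; crw (proj1 pb); reflexivity.
    + intros (c & C1 & C2).
      destruct (proj2 pb _ u c) as (d & [D _] & _); [|exists d; exact D].
      apply (product_eq prod).
      * crw A1; crw I1; symmetry; exact C1.
      * crw A2; crw I2; symmetry; exact C2.
Qed.

(** On the object of triples [(x, y, z)] with
    [x R y] and [x R z], viewed as a point over [R] by [(x, y)] with section
    [(x, y) |-> (x, y, y)], the subobject of those with [y R z] contains the section,
    and the fibre over the diagonal, where [y = x]. Hence it is everything: [R] is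
    Euclidean, and so, being reflexive, symmetric and transitive. *)
Lemma protomodular_maltsev (C : category) (y : C) (r : span y) :
  has_finite_limits C -> protomodular C ->
  is_reflexive_relation r -> is_equivalence_relation r.
Proof.
  intros lim pm [jm refl].
  pose proof (finite_limits_pullbacks lim) as pbs.
  pose proof refl as (e & E1 & E2).
  destruct (pbs _ _ _ (sp_fst r) (sp_fst r)) as (p & p1 & p2 & pb).
  destruct (related_subobject (sp_snd r ∘ p1) (sp_snd r ∘ p2)
              (finite_limits_products lim) pbs jm) as (w & m & mono & Hm).
  destruct (proj2 pb _ (idm _) (idm _) eq_refl) as (s & [S1 S2] & _).
  assert (iso : is_iso m).
  { apply (section_and_fibre_extremal (v := e) (p := p1) (s := s)); auto.
    - apply Hm; crw S1; crw S2; apply reflexive_related; exact refl.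
    - intros t a k E; apply Hm; exists (p2 ∘ a).
      crw E; crw E2; split; [|reflexivity].
      crw (eq_sym (proj1 pb)); crw E; crw E1; reflexivity. }
  assert (eucl : forall (t : C) (a b c : hom t y),
            related r a b -> related r a c -> related r b c).
  { intros t a b c (u & <- & <-) (u' & U & <-).
    destruct (proj2 pb _ u u' (eq_sym U)) as (h & [<- <-] & _).
    destruct iso as (m' & _ & Em).
    rewrite !comp_assoc; apply Hm; exists (m' ∘ h); crw Em; reflexivity. }
  split; [exact jm|]; split; [exact refl|].
  assert (sym : forall (t : C) (a b : hom t y), related r a b -> related r b a).
  { intros t a b H; apply (eucl _ a); [exact H | apply reflexive_related; exact refl]. }
  split; [apply symmetric_related; exact sym|].
  apply related_transitive; intros t a b c Hab; apply eucl, sym; exact Hab.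
Qed.

(** * Lattices of isomorphism classes *)

Record ordered (P : presentation) : Prop := Ordered {
  ord_refl : forall x : P, rep_le x x;
  ord_trans : forall x y z : P, rep_le x y -> rep_le y z -> rep_le x z;
  ord_iso : forall x y : P, rep_iso x y <-> rep_le x y /\ rep_le y x
}.

Definition has_meets (P : presentation) : Prop :=
  forall x y : P, exists m : P,
    rep_le m x /\ rep_le m y /\ forall z : P, rep_le z x -> rep_le z y -> rep_le z m.

Definition has_joins (P : presentation) : Prop :=
  forall x y : P, exists j : P,
    rep_le x j /\ rep_le y j /\ forall z : P, rep_le x z -> rep_le y z -> rep_le j z.

Section Classes.
Variables (P : presentation) (O : ordered P).

Lemma rep_iso_refl (x : P) : rep_iso x x.
Proof. apply (ord_iso O); split; apply (ord_refl O). Qed.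

Lemma rep_iso_sym (x y : P) : rep_iso x y -> rep_iso y x.
Proof. rewrite !(ord_iso O); tauto. Qed.

Lemma rep_iso_trans (x y z : P) : rep_iso x y -> rep_iso y z -> rep_iso x z.
Proof.
  rewrite !(ord_iso O); intros [] []; split; eapply (ord_trans O); eauto.
Qed.

Lemma class_eq (S S' : iso_class P) :
  (forall x, proj1_sig S x <-> proj1_sig S' x) -> S = S'.
Proof.
  destruct S as [S H], S' as [S' H']; simpl; intros E.
  assert (S = S') as <-.
  { apply functional_extensionality; intros x; apply propositional_extensionality, E. }
  f_equal; apply proof_irrelevance.
Qed.

Lemma class_inhabited (S : iso_class P) : exists x, proj1_sig S x.
Proof. destruct S as [S [x H]]; exists x; apply H, rep_iso_refl. Qed.

Lemma class_iso (S : iso_class P) (x y : P) :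
  proj1_sig S x -> (proj1_sig S y <-> rep_iso x y).
Proof.
  destruct S as [S [z H]]; simpl; rewrite !H; intros E; split.
  - apply rep_iso_trans, rep_iso_sym; exact E.
  - apply rep_iso_trans; exact E.
Qed.

Lemma class_le_rep (S S' : iso_class P) (x y : P) :
  proj1_sig S x -> proj1_sig S' y -> (class_le S S' <-> rep_le x y).
Proof.
  intros Hx Hy; split; [intros H; apply H; assumption|].
  intros H a b Ha Hb.
  apply (class_iso a Hx), (ord_iso O) in Ha; apply (class_iso b Hy), (ord_iso O) in Hb.
  destruct Ha as [_ Ha], Hb as [Hb _].
  apply (ord_trans O Ha), (ord_trans O H), Hb.
Qed.

Lemma ordered_lattice : has_meets P -> has_joins P -> lattice_of_classes P.
Proof.
  intros meet join; split.
  - intros S; destruct (class_inhabited S) as [x Hx].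
    apply (class_le_rep Hx Hx), (ord_refl O).
  - intros S S' H H'; apply class_eq; intros y.
    destruct (class_inhabited S) as [x Hx], (class_inhabited S') as [x' Hx'].
    rewrite (class_le_rep Hx Hx') in H; rewrite (class_le_rep Hx' Hx) in H'.
    assert (E : rep_iso x x') by (apply (ord_iso O); auto).
    rewrite (class_iso y Hx), (class_iso y Hx'); split.
    + apply rep_iso_trans, rep_iso_sym; exact E.
    + apply rep_iso_trans; exact E.
  - intros S1 S2 S3.
    destruct (class_inhabited S1) as [x1 H1], (class_inhabited S2) as [x2 H2],
      (class_inhabited S3) as [x3 H3].
    rewrite (class_le_rep H1 H2), (class_le_rep H2 H3), (class_le_rep H1 H3).
    apply (ord_trans O).
  - intros S S'.
    destruct (class_inhabited S) as [x Hx], (class_inhabited S') as [y Hy].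
    destruct (meet x y) as (m & M1 & M2 & M); exists (class_of m).
    assert (Hm : proj1_sig (class_of m) m) by apply rep_iso_refl.
    rewrite (class_le_rep Hm Hx), (class_le_rep Hm Hy); split; [exact M1|].
    split; [exact M2|]; intros T; destruct (class_inhabited T) as [z Hz].
    rewrite (class_le_rep Hz Hx), (class_le_rep Hz Hy), (class_le_rep Hz Hm); apply M.
  - intros S S'.
    destruct (class_inhabited S) as [x Hx], (class_inhabited S') as [y Hy].
    destruct (join x y) as (m & M1 & M2 & M); exists (class_of m).
    assert (Hm : proj1_sig (class_of m) m) by apply rep_iso_refl.
    rewrite (class_le_rep Hx Hm), (class_le_rep Hy Hm); split; [exact M1|].
    split; [exact M2|]; intros T; destruct (class_inhabited T) as [z Hz].
    rewrite (class_le_rep Hx Hz), (class_le_rep Hy Hz), (class_le_rep Hm Hz); apply M.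
Qed.

End Classes.

(** A relation between representatives that becomes an isomorphism of ordered
    collections on classes. The conditions are symmetric in [P] and [Q], so that the
    two inverse maps arise from the same construction. *)
Record correspondence (P Q : presentation) (r : P -> Q -> Prop) : Prop :=
  Correspondence {
  cor_total : forall x, exists x' y, rep_iso x x' /\ r x' y;
  cor_onto : forall y, exists y' x, rep_iso y y' /\ r x y';
  cor_le : forall x y x' y', r x y -> r x' y' -> (rep_le x x' <-> rep_le y y')
}.

Lemma correspondence_flip (P Q : presentation) (r : P -> Q -> Prop) :
  correspondence r -> correspondence (fun y x => r x y).
Proof. intros [T O L]; split; auto; intros; symmetry; apply L; assumption. Qed.

Section Correspondence.
Variables (P Q : presentation) (r : P -> Q -> Prop).
Hypotheses (OP : ordered P) (OQ : ordered Q) (cor : correspondence r).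

Lemma cor_iso (x x' : P) (y y' : Q) :
  r x y -> r x' y' -> (rep_iso x x' <-> rep_iso y y').
Proof.
  intros H H'; rewrite (ord_iso OP), (ord_iso OQ), (cor_le cor H H'), (cor_le cor H' H).
  reflexivity.
Qed.

Definition image_class (S : iso_class P) : iso_class Q.
Proof.
  exists (fun z => exists x y, proj1_sig S x /\ r x y /\ rep_iso y z).
  destruct (class_inhabited OP S) as [x0 H0].
  destruct (cor_total cor x0) as (x & y & Hx & Hxy).
  apply (class_iso OP x H0) in Hx; exists y; intros z; split.
  - intros (x' & y' & Hx' & Hxy' & E).
    apply (rep_iso_trans OQ (y := y')); [|exact E].
    apply (cor_iso Hxy Hxy'), (class_iso OP x' Hx); exact Hx'.
  - intros E; exists x, y; auto.
Defined.

Lemma image_class_le (S S' : iso_class P) :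
  class_le S S' <-> class_le (image_class S) (image_class S').
Proof.
  assert (Rep : forall T, exists x y,
            proj1_sig T x /\ r x y /\ proj1_sig (image_class T) y).
  { intros T; destruct (class_inhabited OP T) as [x0 H0].
    destruct (cor_total cor x0) as (x & y & Hx & Hxy).
    apply (class_iso OP x H0) in Hx; exists x, y; split; [exact Hx|].
    split; [exact Hxy|]; exists x, y; pose proof (rep_iso_refl OQ y); auto. }
  destruct (Rep S) as (x & y & Hx & Hxy & Hy), (Rep S') as (x' & y' & Hx' & Hxy' & Hy').
  rewrite (class_le_rep OP Hx Hx'), (class_le_rep OQ Hy Hy'); apply (cor_le cor); auto.
Qed.

Lemma correspondence_meets : has_meets P -> has_meets Q.
Proof.
  intros meet y1 y2.
  destruct (cor_onto cor y1) as (y1' & x1 & E1 & R1), (cor_onto cor y2) as (y2' & x2 & E2 & R2).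
  destruct (meet x1 x2) as (m0 & L1 & L2 & L).
  destruct (cor_total cor m0) as (m & n & E & R).
  apply (ord_iso OQ) in E1 as [E1 E1'], E2 as [E2 E2']; apply (ord_iso OP) in E as [E E'].
  exists n; split; [|split].
  - refine (ord_trans OQ _ E1'); apply (cor_le cor R R1), (ord_trans OP E'), L1.
  - refine (ord_trans OQ _ E2'); apply (cor_le cor R R2), (ord_trans OP E'), L2.
  - intros z Z1 Z2; destruct (cor_onto cor z) as (z' & w & Ez & Rz).
    apply (ord_iso OQ) in Ez as [Ez Ez'].
    apply (ord_trans OQ Ez), (cor_le cor Rz R); refine (ord_trans OP _ E); apply L.
    + apply (cor_le cor Rz R1), (ord_trans OQ Ez'), (ord_trans OQ Z1), E1.
    + apply (cor_le cor Rz R2), (ord_trans OQ Ez'), (ord_trans OQ Z2), E2.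
Qed.

Lemma correspondence_joins : has_joins P -> has_joins Q.
Proof.
  intros join y1 y2.
  destruct (cor_onto cor y1) as (y1' & x1 & E1 & R1), (cor_onto cor y2) as (y2' & x2 & E2 & R2).
  destruct (join x1 x2) as (m0 & L1 & L2 & L).
  destruct (cor_total cor m0) as (m & n & E & R).
  apply (ord_iso OQ) in E1 as [E1 E1'], E2 as [E2 E2']; apply (ord_iso OP) in E as [E E'].
  exists n; split; [|split].
  - apply (ord_trans OQ E1), (cor_le cor R1 R), (ord_trans OP L1), E.
  - apply (ord_trans OQ E2), (cor_le cor R2 R), (ord_trans OP L2), E.
  - intros z Z1 Z2; destruct (cor_onto cor z) as (z' & w & Ez & Rz).
    apply (ord_iso OQ) in Ez as [Ez Ez'].
    refine (ord_trans OQ _ Ez'); apply (cor_le cor R Rz), (ord_trans OP E'), L.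
    + apply (cor_le cor R1 Rz), (ord_trans OQ E1'), (ord_trans OQ Z1), Ez.
    + apply (cor_le cor R2 Rz), (ord_trans OQ E2'), (ord_trans OQ Z2), Ez.
Qed.

End Correspondence.

Lemma image_class_flip (P Q : presentation) (r : P -> Q -> Prop)
    (OP : ordered P) (OQ : ordered Q) (cor : correspondence r) (S : iso_class P) :
  image_class OQ OP (correspondence_flip cor) (image_class OP OQ cor S) = S.
Proof.
  apply class_eq; intros x; simpl; split.
  - intros (y & x' & (x1 & y1 & H1 & R1 & E1) & R' & E').
    apply (class_iso OP x H1), (rep_iso_trans OP (y := x')); [|exact E'].
    apply (cor_iso OP OQ cor R1 R'); exact E1.
  - intros Hx; destruct (cor_total cor x) as (x' & y & E & R).
    exists y, x'; split; [|split; [exact R | apply (rep_iso_sym OP), E]].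
    exists x', y; split; [apply (class_iso OP x' Hx), E|].
    split; [exact R | apply (rep_iso_refl OQ)].
Qed.

Lemma correspondence_induces (P Q : presentation) (r : P -> Q -> Prop) :
  ordered P -> ordered Q -> correspondence r -> (forall x, exists y, r x y) ->
  induces_order_iso r.
Proof.
  intros OP OQ cor total; split; [exact total|].
  exists (image_class OP OQ cor), (image_class OQ OP (correspondence_flip cor)).
  split; [|split; [|split]].
  - intros x y H; apply class_eq; intros z; simpl; split.
    + intros (x' & y' & E & R & E').
      apply (rep_iso_trans OQ (y := y')); [|exact E'].
      apply (cor_iso OP OQ cor H R); exact E.
    + intros E; exists x, y; pose proof (rep_iso_refl OP x); auto.
  - apply image_class_flip.
  - intros S; refine (eq_trans _ (image_class_flip OQ OP (correspondence_flip cor) S)).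
    apply class_eq; intros y; reflexivity.
  - apply image_class_le.
Qed.

(** * Relations and quotients *)

Lemma span_iso_incl (C : category) (y : C) (r s : span y) :
  jointly_monic r -> jointly_monic s ->
  (span_iso r s <-> span_incl r s /\ span_incl s r).
Proof.
  intros jr js; split.
  - intros (h & (h' & E1 & E2) & H1 & H2); split; [exists h; auto|].
    exists h'; rewrite <- H1, <- H2, <- !comp_assoc, E2, !comp_idr; auto.
  - intros [(h & H1 & H2) (h' & H1' & H2')]; exists h; split; [|auto].
    exists h'; split; [apply jr | apply js];
      rewrite !comp_assoc, ?H1', ?H2', ?H1, ?H2, ?H1', ?H2', comp_idr; reflexivity.
Qed.

Lemma span_incl_refl (C : category) (y : C) (r : span y) : span_incl r r.
Proof. exists (idm _); rewrite !comp_idr; auto. Qed.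

Lemma span_incl_trans (C : category) (y : C) (r s t : span y) :
  span_incl r s -> span_incl s t -> span_incl r t.
Proof. rewrite !span_incl_related; auto. Qed.

Lemma ERel_ordered (C : category) (y : C) : ordered (ERel y).
Proof.
  split; simpl.
  - intros x; apply span_incl_refl.
  - intros r s t; apply span_incl_trans.
  - intros [r Hr] [s Hs]; simpl; apply span_iso_incl; [apply Hr | apply Hs].
Qed.

Lemma RRel_ordered (C : category) (y : C) : ordered (RRel y).
Proof.
  split; simpl.
  - intros x; apply span_incl_refl.
  - intros r s t; apply span_incl_trans.
  - intros [r Hr] [s Hs]; simpl; apply span_iso_incl; [apply Hr | apply Hs].
Qed.

(** A regular epimorphism is the coequalizer of its kernel pair, so inclusion of kernel
    pairs is what a factorization requires. *)
Lemma quot_le_factors (C : category) (y : C) (q q' : Quot y) :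
  has_pullbacks C ->
  (rep_le q q' <-> exists h : hom (qm_ob q) (qm_ob q'), h ∘ qm_mor q = qm_mor q').
Proof.
  intros pbs; simpl; split.
  - intros H.
    destruct (kernel_pair_exists (qm_mor q) pbs) as [r Hr].
    destruct (kernel_pair_exists (qm_mor q') pbs) as [r' Hr'].
    pose proof (H r r' Hr Hr') as incl.
    destruct (proj2 (regular_epi_coequalizer (qm_regular q) Hr) _ (qm_mor q'))
      as (h & Eh & _); [|exists h; exact Eh].
    apply (kernel_pair_related Hr'), (proj1 (span_incl_related r r') incl), related_proj.
  - intros [h Eh] r r' Hr Hr'; apply span_incl_related; intros t a b.
    rewrite (kernel_pair_related Hr), (kernel_pair_related Hr'), <- Eh.
    intros E; rewrite <- !comp_assoc, E; reflexivity.
Qed.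

Lemma Quot_ordered (C : category) (y : C) : has_pullbacks C -> ordered (Quot y).
Proof.
  intros pbs; split.
  - intros q; apply quot_le_factors; [exact pbs|]; exists (idm _); apply comp_idl.
  - intros q q' q''; rewrite !quot_le_factors by exact pbs; intros [h <-] [h' <-].
    exists (h' ∘ h); symmetry; apply comp_assoc.
  - intros q q'; rewrite !quot_le_factors by exact pbs; simpl; split.
    + intros (h & (h' & E1 & E2) & <-); split; [exists h; reflexivity|].
      exists h'; crw E1; reflexivity.
    + intros [[h H] [h' H']]; exists h; split; [exists h'; split | exact H].
      * apply (regular_epi_epi (qm_regular q)); crw H; crw H'; reflexivity.
      * apply (regular_epi_epi (qm_regular q')); crw H'; crw H; reflexivity.
Qed.

Lemma quot_erel_total (C : category) (y : C) (q : Quot y) :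
  has_pullbacks C -> exists r : ERel y, quot_erel q r.
Proof.
  intros pbs; destruct (kernel_pair_exists (qm_mor q) pbs) as [r Hr].
  exists (exist _ r (kernel_pair_equivalence Hr)); exact Hr.
Qed.

Lemma quot_erel_correspondence (C : category) (y : C) :
  barr_exact C -> correspondence (@quot_erel C y).
Proof.
  intros [reg eff]; pose proof (regular_has_pullbacks reg) as pbs.
  pose proof (Quot_ordered y pbs) as OQ; pose proof (ERel_ordered y) as OE.
  split.
  - intros q; destruct (quot_erel_total q pbs) as [r Hr].
    exists q, r; split; [apply (rep_iso_refl OQ) | exact Hr].
  - intros [r Hr]; destruct (eff _ _ Hr) as (z & f & Hf).
    destruct (kernel_pair_coequalizer reg Hf) as (q & e & He & Ke & _).
    exists (exist _ r Hr), (QuotientMap He); split; [apply (rep_iso_refl OE) | exact Ke].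
  - intros q [r Hr] q' [r' Hr'] K K'; simpl; unfold quot_erel in K, K'; simpl in K, K'.
    split; [intros H; exact (H r r' K K')|].
    intros H s s' L L'; apply span_incl_related; intros t a b.
    rewrite (kernel_pair_related L), (kernel_pair_related L').
    rewrite <- (kernel_pair_related K), <- (kernel_pair_related K').
    apply span_incl_related; exact H.
Qed.

Definition maltsev_at (C : category) (y : C) : Prop :=
  forall r : span y, is_reflexive_relation r -> is_equivalence_relation r.

Lemma erel_rrel_total (C : category) (y : C) (r : ERel y) :
  exists s : RRel y, erel_rrel r s.
Proof.
  destruct r as [r (jm & refl & H)].
  exists (exist _ r (conj jm refl)); reflexivity.
Qed.

Lemma erel_rrel_correspondence (C : category) (y : C) :
  maltsev_at y -> correspondence (@erel_rrel C y).
Proof.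
  intros mal; split.
  - intros r; destruct (erel_rrel_total r) as [s H]; exists r, s.
    split; [apply (rep_iso_refl (ERel_ordered y)) | exact H].
  - intros s; exists s, (exist _ (proj1_sig s) (mal _ (proj2_sig s))).
    split; [apply (rep_iso_refl (RRel_ordered y)) | reflexivity].
  - intros r s r' s' E E'; unfold erel_rrel in E, E'; simpl; rewrite E, E'; reflexivity.
Qed.

Lemma RRel_meets (C : category) (y : C) : has_finite_limits C -> has_meets (RRel y).
Proof.
  intros lim [r [jr er]] [s [js es]].
  destruct (related_subobject (sp_fst r) (sp_snd r) (finite_limits_products lim)
              (finite_limits_pullbacks lim) js) as (w & m & mono & Hm).
  pose (i := @Span C y w (sp_fst r ∘ m) (sp_snd r ∘ m)).
  assert (Hi : forall t (a b : hom t y),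
            related i a b <-> related r a b /\ related s a b).
  { intros t a b; split.
    - intros (c & <- & <-); simpl; rewrite <- !comp_assoc; split.
      + exists (m ∘ c); auto.
      + apply Hm; exists c; reflexivity.
    - intros [(c & <- & <-) H]; apply Hm in H; destruct H as [d <-].
      exists d; simpl; rewrite <- !comp_assoc; auto. }
  assert (ji : jointly_monic i).
  { intros t a b E1 E2; simpl in E1, E2; apply mono, jr; rewrite !comp_assoc; assumption. }
  assert (ei : reflexive i).
  { apply (Hi y (idm y) (idm y)); split; apply reflexive_related; assumption. }
  exists (exist _ i (conj ji ei)); simpl; split; [|split].
  - apply span_incl_related; intros t a b H; apply Hi, H.
  - apply span_incl_related; intros t a b H; apply Hi, H.
  - intros [z Hz]; simpl; rewrite !span_incl_related; intros Z1 Z2 t a b H.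
    apply Hi; auto.
Qed.

(** The join is the composite relation, the image of [r x_y s] in [y x y]: it is
    reflexive, hence an equivalence relation. *)
Lemma RRel_joins (C : category) (y : C) :
  is_regular C -> maltsev_at y -> has_joins (RRel y).
Proof.
  intros reg mal [r Hr] [s Hs].
  pose proof (regular_has_pullbacks reg) as pbs.
  destruct (finite_limits_products (proj1 reg) y y) as (yy & p1 & p2 & prod).
  destruct (pbs _ _ _ (sp_snd r) (sp_fst s)) as (p & a1 & a2 & pb).
  destruct (prod _ (sp_fst r ∘ a1) (sp_snd s ∘ a2)) as (f & [F1 F2] & _).
  destruct (regular_image f reg) as (w & e & m & He & mono & Em).
  pose (j := @Span C y w (p1 ∘ m) (p2 ∘ m)).
  assert (Hj : forall t (a b c : hom t y),
            related r a b -> related s b c -> related j a c).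
  { intros t a b c (u & <- & <-) (v & E & <-).
    destruct (proj2 pb _ u v (eq_sym E)) as (h & [<- <-] & _).
    exists (e ∘ h); simpl; split; crw Em.
    - crw F1; reflexivity.
    - crw F2; reflexivity. }
  assert (jj : jointly_monic j).
  { intros t a b E1 E2; simpl in E1, E2; apply mono, (product_eq prod);
      rewrite !comp_assoc; assumption. }
  assert (ej : reflexive j).
  { apply (Hj y (idm y) (idm y) (idm y)); apply reflexive_related; [apply Hr | apply Hs]. }
  exists (exist _ j (conj jj ej)); simpl; split; [|split].
  - apply span_incl_related; intros t a b H; apply (Hj t a b b H).
    apply reflexive_related, Hs.
  - apply span_incl_related; intros t a b H; refine (Hj t a a b _ H).
    apply reflexive_related, Hr.
  - intros [z Hz]; simpl; intros Z1 Z2.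
    pose proof (mal _ Hz) as (jz & _ & _ & tz).
    destruct (transitive_related pbs tz
                (a := sp_fst r ∘ a1) (b := sp_snd r ∘ a1) (c := sp_snd s ∘ a2))
      as (c & C1 & C2).
    + apply related_precomp, (proj1 (span_incl_related r z) Z1), related_proj.
    + rewrite (proj1 pb).
      apply related_precomp, (proj1 (span_incl_related s z) Z2), related_proj.
    + destruct (prod _ (sp_fst z) (sp_snd z)) as (n & [N1 N2] & _).
      destruct (@regular_epi_orthogonal C _ _ _ _ e n c m He) as (d & _ & D).
      * intros t a b E; apply jz; [rewrite <- N1 | rewrite <- N2]; crw E; reflexivity.
      * apply (product_eq prod); rewrite Em.
        -- crw N1; rewrite C1, F1; reflexivity.
        -- crw N2; rewrite C2, F2; reflexivity.
      * exists d; simpl; rewrite <- N1, <- N2, <- D, !comp_assoc; auto.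
Qed.

(** * Normal subobjects *)

Lemma zero_morphism_eq (C : category) (x y : C) (f g : hom x y) :
  is_zero_morphism f -> is_zero_morphism g -> f = g.
Proof.
  intros (z & u & v & [Zi _] & ->) (z' & u' & v' & [_ Zt'] & ->).
  destruct (Zi z') as (w & _ & _).
  rewrite (exists_unique_eq (a := v) (b := v' ∘ w) (Zi y) I I).
  rewrite <- comp_assoc; f_equal; exact (exists_unique_eq (Zt' x) I I).
Qed.

Lemma zero_morphism_precomp (C : category) (w x y : C) (f : hom x y) (g : hom w x) :
  is_zero_morphism f -> is_zero_morphism (f ∘ g).
Proof.
  intros (z & u & v & Z & ->); exists z, (u ∘ g), v; split; [exact Z|].
  symmetry; apply comp_assoc.
Qed.

Lemma zero_morphism_postcomp (C : category) (w x y : C) (f : hom x y) (g : hom w x) :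
  is_zero_morphism g -> is_zero_morphism (f ∘ g).
Proof.
  intros (z & u & v & Z & ->); exists z, u, (f ∘ v); split; [exact Z|].
  apply comp_assoc.
Qed.

Lemma kernel_exists (C : category) (x y : C) (f : hom x y) :
  (exists z : C, is_zero_object z) -> has_pullbacks C ->
  exists (k : C) (n : hom k x), is_kernel f n.
Proof.
  intros (z & Zi & Zt) pbs.
  destruct (Zi y) as (v & _ & _).
  destruct (pbs _ _ _ f v) as (k & n & k' & pb).
  exists k, n; split.
  - exists z, k', v; split; [split; assumption | exact (proj1 pb)].
  - intros t h Hh; destruct (Zt t) as (u & _ & _).
    destruct (proj2 pb _ h u) as (c & [E _] & _).
    + apply zero_morphism_eq; [exact Hh|].
      exists z, u, v; split; [split; assumption | reflexivity].
    + exists c; split; [exact E|]; intros d D.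
      apply (pullback_eq pb); [congruence | exact (exists_unique_eq (Zt t) I I)].
Qed.

Lemma kernel_mono (C : category) (k x y : C) (f : hom x y) (n : hom k x) :
  is_kernel f n -> is_mono n.
Proof.
  intros [Z univ] t a b E.
  apply (exists_unique_eq (P := fun u => n ∘ u = n ∘ b)); auto.
  apply univ; rewrite comp_assoc; apply zero_morphism_precomp, Z.
Qed.

(** On the kernel pair [(r1, r2)] of [e], the equalizer of [g r1] and [g r2] contains
    the diagonal, which is a section of [r1], and the fibre of [r1] over zero, which
    consists of the pairs [(0, n c)]. Hence [g r1 = g r2], and [g] factors through the
    coequalizer [e]. *)
Lemma regular_epi_cokernel (C : category) (k x y w : C) (e : hom x y) (n : hom k x)
    (g : hom x w) :
  (exists z : C, is_zero_object z) -> has_finite_limits C -> protomodular C ->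
  is_regular_epi e -> is_kernel e n -> is_zero_morphism (g ∘ n) ->
  exists h : hom y w, h ∘ e = g.
Proof.
  intros (z & Z) lim pm He [_ univ] Hg.
  pose proof (finite_limits_pullbacks lim) as pbs.
  destruct (kernel_pair_exists e pbs) as [r Hr].
  destruct (kernel_pair_equivalence Hr) as (_ & (d & D1 & D2) & _).
  destruct (@related_subobject C w (Span (idm w) (idm w)) (sp_ob r)
              (g ∘ sp_fst r) (g ∘ sp_snd r) (finite_limits_products lim) pbs)
    as (v & m & mono & Hm).
  { intros t a b E _; simpl in E; rewrite !comp_idl in E; exact E. }
  assert (Eq : forall t (u : hom t (sp_ob r)),
            g ∘ sp_fst r ∘ u = g ∘ sp_snd r ∘ u -> exists c, m ∘ c = u).
  { intros t u E; apply Hm; exists (g ∘ sp_fst r ∘ u); simpl; rewrite !comp_idl; auto. }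
  destruct (proj1 Z x) as (o & _ & _).
  assert (iso : is_iso m).
  { apply (section_and_fibre_extremal (v := o) (p := sp_fst r) (s := d)); auto.
    - apply Eq; rewrite <- !comp_assoc, D1, D2; reflexivity.
    - intros t a c E; apply Eq.
      assert (Za : is_zero_morphism (sp_fst r ∘ a)) by (exists z, c, o; auto).
      rewrite <- !comp_assoc; apply zero_morphism_eq.
      { apply zero_morphism_postcomp, Za. }
      destruct (univ t (sp_snd r ∘ a)) as (u & <- & _).
      + crw (eq_sym (proj1 Hr)); apply zero_morphism_postcomp, Za.
      + rewrite comp_assoc; apply zero_morphism_precomp, Hg. }
  destruct iso as (m' & _ & E).
  destruct (proj2 (regular_epi_coequalizer He Hr) _ g) as (h & Eh & _);
    [|exists h; exact Eh].
  destruct (proj1 (Hm _ (idm _))) as (c & C1 & C2); [exists m'; exact E|].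
  simpl in C1, C2; rewrite comp_idl, comp_idr in C1, C2; congruence.
Qed.

Lemma NSub_ordered (C : category) (y : C) : ordered (NSub y).
Proof.
  split; simpl.
  - intros n; exists (idm _); apply comp_idr.
  - intros n n' n'' [h <-] [h' <-]; exists (h' ∘ h); apply comp_assoc.
  - intros n n'.
    destruct (nm_normal n) as (z & f & K), (nm_normal n') as (z' & f' & K').
    split.
    + intros (h & (h' & E1 & E2) & <-); split; [exists h; reflexivity|].
      exists h'; crw E2; reflexivity.
    + intros [[h H] [h' H']]; exists h; split; [exists h'; split | exact H].
      * apply (kernel_mono K); crw H'; crw H; reflexivity.
      * apply (kernel_mono K'); crw H; crw H'; reflexivity.
Qed.

Lemma quot_nsub_total (C : category) (y : C) (q : Quot y) :
  (exists z : C, is_zero_object z) -> has_pullbacks C -> exists n : NSub y, quot_nsub q n.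
Proof.
  intros Z pbs; destruct (kernel_exists (qm_mor q) Z pbs) as (k & n & K).
  unshelve eexists (@NormalMono C y k n _); [eexists _, _; exact K | exact K].
Qed.

Lemma quot_nsub_correspondence (C : category) (y : C) :
  semi_abelian C -> correspondence (@quot_nsub C y).
Proof.
  intros (Z & [reg _] & pm & _); pose proof (regular_has_pullbacks reg) as pbs.
  split.
  - intros q; destruct (quot_nsub_total q Z pbs) as [n H]; exists q, n.
    split; [apply (rep_iso_refl (Quot_ordered y pbs)) | exact H].
  - intros n; destruct (nm_normal n) as (w & f & Kz & K).
    destruct (kernel_pair_exists f pbs) as [r Hr].
    destruct (kernel_pair_coequalizer reg Hr) as (q & e & He & Ke & m & Em).
    exists n, (QuotientMap He); split; [apply (rep_iso_refl (NSub_ordered y))|].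
    (* [e] and [f] identify the same pairs, in particular the same pairs [(h, 0)]. *)
    assert (same : forall t (h : hom t y), is_zero_morphism (f ∘ h) <-> is_zero_morphism (e ∘ h)).
    { intros t h; split; [|intros H; rewrite <- Em, <- comp_assoc;
                           apply zero_morphism_postcomp, H].
      intros H; destruct Z as (z & Zi & Zt).
      destruct (Zt t) as (u & _ & _), (Zi y) as (v & _ & _).
      assert (H0 : is_zero_morphism (v ∘ u))
        by (exists z, u, v; split; [split; assumption | reflexivity]).
      assert (E : e ∘ h = e ∘ (v ∘ u)).
      { apply (kernel_pair_related Ke), (kernel_pair_related Hr), zero_morphism_eq;
          [exact H | apply zero_morphism_postcomp, H0]. }
      rewrite E; apply zero_morphism_postcomp, H0. }
    split; simpl.
    + apply same, Kz.
    + intros t h Hh; apply K, same, Hh.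
  - intros q n q' n' [K1 K2] [K1' K2']; rewrite (quot_le_factors q q' pbs); split.
    + intros [h Eh]; destruct (K2' _ (nm_mor n)) as (u & E & _); [|exists u; exact E].
      rewrite <- Eh, <- comp_assoc; apply zero_morphism_postcomp, K1.
    + intros [u E].
      apply (regular_epi_cokernel (n := nm_mor n)); auto.
      * exact (proj1 reg).
      * apply qm_regular.
      * split; assumption.
      * rewrite <- E, comp_assoc; apply zero_morphism_precomp, K1'.
Qed.

(** * Equivalences and monadic functors *)

Lemma retraction_faithful (C D : category) (F : functor C D) (G : functor D C) :
  naturally_isomorphic (comp_functor G F) (id_functor C) ->
  forall (x y : C) (f g : hom x y), fmap F f = fmap F g -> f = g.
Proof.
  intros [t iso] x y f g E; destruct (iso x) as (i & _ & I2).
  pose proof (naturality t f) as Nf; pose proof (naturality t g) as Ng; simpl in *.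
  rewrite E in Nf.
  rewrite <- (comp_idr f), <- (comp_idr g), <- I2, !comp_assoc; congruence.
Qed.

Lemma equivalence_faithful (C D : category) (F : functor C D) :
  is_equivalence F -> forall (x y : C) (f g : hom x y), fmap F f = fmap F g -> f = g.
Proof. intros (G & H & _); exact (retraction_faithful H). Qed.

Lemma equivalence_full (C D : category) (F : functor C D) :
  is_equivalence F -> forall (x y : C) (g : hom (F x) (F y)), exists f, fmap F f = g.
Proof.
  intros (G & [t iso] & H) x y g.
  destruct (iso x) as (i & I1 & I2), (iso y) as (j & J1 & J2); simpl in *.
  exists (t y ∘ (fmap G g ∘ i)).
  apply (retraction_faithful H).
  set (f := t y ∘ (fmap G g ∘ i)).
  pose proof (naturality t f) as N; simpl in N.
  rewrite <- (comp_idl (fmap G _)), <- J1, <- comp_assoc, N.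
  unfold f; crw I1; crw J1; reflexivity.
Qed.

Lemma equivalence_essentially_surjective (C D : category) (F : functor C D) :
  is_equivalence F -> forall d : D, exists (c : C) (h : hom (F c) d), is_iso h.
Proof. intros (G & _ & [t iso]) d; exists (G d), (t d); apply iso. Qed.

Section Monadic.
Variables (A X : category) (U : functor A X) (F : left_adjoint U).

Lemma adjunct_eq (t : X) (a : A) (f g : hom t (U a)) :
  la_counit F a ∘ fmap F f = la_counit F a ∘ fmap F g -> f = g.
Proof.
  assert (K : forall h : hom t (U a),
            h = fmap U (la_counit F a ∘ fmap F h) ∘ la_unit F t).
  { intros h; rewrite (fmap_comp U), <- comp_assoc.
    transitivity (fmap U (la_counit F a) ∘ (la_unit F (U a) ∘ h));
      [|f_equal; exact (naturality (la_unit F) h)].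
    symmetry; rewrite comp_assoc; transitivity (idm (U a) ∘ h); [|apply comp_idl].
    f_equal; apply la_triangle_r. }
  intros E; rewrite (K f), (K g), E; reflexivity.
Qed.

Lemma map_span_jointly_monic (a : A) (r : span a) :
  jointly_monic r -> jointly_monic (map_span U r).
Proof.
  intros jm t f g E1 E2; simpl in *; apply adjunct_eq.
  assert (N : forall (b : A) (k : hom (sp_ob r) b) (h : hom t (U (sp_ob r))),
            k ∘ (la_counit F (sp_ob r) ∘ fmap F h) = la_counit F b ∘ fmap F (fmap U k ∘ h)).
  { intros b k h; rewrite (fmap_comp F), !comp_assoc.
    f_equal; exact (eq_sym (naturality (la_counit F) k)). }
  apply jm; rewrite !N, ?E1, ?E2; reflexivity.
Qed.

Hypothesis mon : monadic F.

Lemma monadic_faithful (a b : A) (f g : hom a b) : fmap U f = fmap U g -> f = g.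
Proof. intros E; apply (equivalence_faithful mon), algebra_hom_eq; exact E. Qed.

Lemma monadic_full (a b : A) (g : hom (U a) (U b)) :
  g ∘ fmap U (la_counit F a) = fmap U (la_counit F b) ∘ fmap U (fmap F g) ->
  exists f : hom a b, fmap U f = g.
Proof.
  intros E.
  destruct (equivalence_full mon (x := a) (y := b)
    (@AlgebraHom X (induced_monad F) (comparison_ob F a) (comparison_ob F b) g E)) as [f Ef].
  exists f; exact (f_equal (@ah_mor _ _ _ _) Ef).
Qed.

Lemma monadic_algebra (x : algebra (induced_monad F)) :
  exists (a : A) (h : hom (U a) (alg_ob x)), is_iso h /\
    h ∘ fmap U (la_counit F a) = alg_act x ∘ fmap U (fmap F h).
Proof.
  destruct (equivalence_essentially_surjective mon x) as (a & h & h' & E1 & E2).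
  exists a, (ah_mor h); split; [|exact (ah_act h)].
  exists (ah_mor h'); split;
    [exact (f_equal (@ah_mor _ _ _ _) E1) | exact (f_equal (@ah_mor _ _ _ _) E2)].
Qed.

(** The map into [U r] witnessing the relation is automatically a morphism of algebras,
    since the two projections are jointly monic morphisms of algebras. *)
Lemma related_map_span (a : A) (r : span a) (t : A) (f g : hom t a) :
  jointly_monic r -> related (map_span U r) (fmap U f) (fmap U g) -> related r f g.
Proof.
  intros jm (c & C1 & C2); simpl in *.
  assert (N : forall (x y : A) (k : hom x y),
            fmap U k ∘ fmap U (la_counit F x) =
            fmap U (la_counit F y) ∘ fmap U (fmap F (fmap U k))).
  { intros x y k; rewrite <- !(fmap_comp U); f_equal.
    exact (eq_sym (naturality (la_counit F) k)). }
  destruct (@monadic_full t (sp_ob r) c) as [h Eh].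
  - assert (K : forall (k : hom (sp_ob r) a) (u : hom t a), fmap U k ∘ c = fmap U u ->
      fmap U k ∘ (c ∘ fmap U (la_counit F t)) =
      fmap U k ∘ (fmap U (la_counit F (sp_ob r)) ∘ fmap U (fmap F c))).
    { intros k u E; rewrite comp_assoc, E, N, comp_assoc, N, <- E, (fmap_comp F).
      rewrite (fmap_comp U); apply comp_assoc. }
    apply (map_span_jointly_monic jm); [exact (K _ _ C1) | exact (K _ _ C2)].
  - exists h; split; apply monadic_faithful; rewrite (fmap_comp U), Eh; assumption.
Qed.

Lemma span_incl_map_span (a : A) (r s : span a) :
  jointly_monic s -> (span_incl r s <-> span_incl (map_span U r) (map_span U s)).
Proof.
  intros jm; split.
  - intros [h [E1 E2]]; exists (fmap U h); simpl; rewrite <- !(fmap_comp U), E1, E2; auto.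
  - intros H; apply (related_map_span jm); exact H.
Qed.

Lemma map_span_reflexive_relation (a : A) (r : span a) :
  is_reflexive_relation r -> is_reflexive_relation (map_span U r).
Proof.
  intros [jm (e & E1 & E2)]; split; [exact (map_span_jointly_monic jm)|].
  exists (fmap U e); simpl; rewrite <- !(fmap_comp U), E1, E2; split; apply fmap_id.
Qed.

(** The witnesses of symmetry and transitivity of [U r] come from maps of [A], by
    [related_map_span]. *)
Lemma monadic_maltsev (a : A) : has_pullbacks X -> maltsev_at (U a) -> maltsev_at a.
Proof.
  intros pbs mal r Hr.
  destruct (mal _ (map_span_reflexive_relation Hr)) as (_ & _ & sym & tr).
  destruct Hr as [jm refl]; split; [exact jm|]; split; [exact refl|]; split.
  - apply (related_map_span jm), (proj1 (symmetric_related (map_span U r)) sym).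
    exact (related_proj (map_span U r)).
  - intros p p1 p2 [sq _].
    apply (related_map_span jm).
    apply (transitive_related pbs tr (b := fmap U (sp_snd r ∘ p1))).
    + exists (fmap U p1); simpl; rewrite !(fmap_comp U); auto.
    + exists (fmap U p2); simpl; rewrite sq, !(fmap_comp U); auto.
Qed.

Lemma rrel_apply_total (a : A) (r : RRel a) : exists s : RRel (U a), rrel_apply r s.
Proof.
  exists (exist _ _ (map_span_reflexive_relation (proj2_sig r))); reflexivity.
Qed.

End Monadic.

(** * Reflexive relations on algebras *)

Lemma finite_coproducts_binary (C : category) (x y : C) :
  has_finite_coproducts C ->
  exists (s : C) (i : hom x s) (j : hom y s), is_binary_coproduct i j.
Proof.
  intros cop.
  destruct (cop bool (fun b => if b then x else y)) as (s & inj & H).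
  { exists (true :: false :: nil); intros []; simpl; auto. }
  exists s, (inj true), (inj false); intros t f g.
  destruct (H t (fun b => match b return hom (if b then x else y) t with
                          | true => f | false => g end)) as (u & E & uniq).
  exists u; split; [split; [exact (E true) | exact (E false)]|].
  intros v [V1 V2]; apply uniq; intros []; assumption.
Qed.

Lemma binary_coproduct_eq (C : category) (x y s t : C) (i : hom x s) (j : hom y s)
    (u v : hom s t) :
  is_binary_coproduct i j -> u ∘ i = v ∘ i -> u ∘ j = v ∘ j -> u = v.
Proof.
  intros H E1 E2.
  apply (exists_unique_eq (P := fun w => w ∘ i = v ∘ i /\ w ∘ j = v ∘ j)
           (a := u) (b := v)); auto.
Qed.

Lemma finite_coproducts_initial (C : category) :
  has_finite_coproducts C -> exists z : C, is_initial z.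
Proof.
  intros cop.
  destruct (cop Empty_set (fun e => match e with end)) as (z & inj & H).
  { exists nil; intros []. }
  exists z; intros x; destruct (H x (fun e => match e with end)) as (u & _ & uniq).
  exists u; split; [exact I|]; intros v _; apply uniq; intros [].
Qed.

Lemma alg_act_unit (X : category) (T : monad X) (x : algebra T) (y : X)
    (k : hom y (alg_ob x)) : alg_act x ∘ (fmap T k ∘ m_unit T y) = k.
Proof.
  transitivity (alg_act x ∘ (m_unit T (alg_ob x) ∘ k)).
  - f_equal; exact (eq_sym (naturality (m_unit T) k)).
  - rewrite comp_assoc, alg_unit; apply comp_idl.
Qed.

(** This is where essential nullarity enters. The two maps [T R -> T x -> x] induced by
    the projections of [R] agree on [T 0], hence land there in the diagonal, and on
    [R] they are the projections themselves. So the pair of them factors through the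
    monomorphism [R -> x * x] on [T 0 + R], and therefore on [T R]. *)
Lemma reflexive_relation_subalgebra (X : category) (T : monad X) (x : algebra T)
    (r : span (alg_ob x)) :
  has_finite_limits X -> has_finite_coproducts X -> essentially_nullary T ->
  is_reflexive_relation r ->
  exists d : hom (T (sp_ob r)) (sp_ob r),
    sp_fst r ∘ d = alg_act x ∘ fmap T (sp_fst r) /\
    sp_snd r ∘ d = alg_act x ∘ fmap T (sp_snd r).
Proof.
  intros lim cop nul [jm (e & E1 & E2)].
  destruct (finite_coproducts_initial cop) as [z Hz].
  destruct (finite_coproducts_binary (T z) (sp_ob r) cop) as (s & i & j & Hs).
  destruct (Hz (sp_ob r)) as (b & _ & _).
  destruct (Hs _ (fmap T b) (m_unit T (sp_ob r))) as (c & [Ci Cj] & _).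
  destruct (nul _ _ _ _ _ _ _ Hz Hs Ci Cj) as [_ strong].
  destruct (finite_limits_products lim (alg_ob x) (alg_ob x)) as (xx & p1 & p2 & prod).
  destruct (prod _ (sp_fst r) (sp_snd r)) as (m & [M1 M2] & _).
  destruct (prod _ (alg_act x ∘ fmap T (sp_fst r)) (alg_act x ∘ fmap T (sp_snd r)))
    as (v & [V1 V2] & _).
  destruct (Hs _ (e ∘ (alg_act x ∘ fmap T (sp_fst r ∘ b))) (idm _)) as (u & [Ui Uj] & _).
  assert (Eb : sp_fst r ∘ b = sp_snd r ∘ b) by exact (exists_unique_eq (Hz _) I I).
  destruct (strong _ _ m) with (u := u) (v := v) as (d & [_ D] & _).
  - intros t f g E; apply jm; rewrite <- ?M1, <- ?M2; crw E; reflexivity.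
  - apply (product_eq prod); rewrite !comp_assoc, ?M1, ?M2, ?V1, ?V2.
    + apply (binary_coproduct_eq Hs); rewrite <- !comp_assoc.
      * rewrite Ui, Ci; crw E1; rewrite (fmap_comp T); reflexivity.
      * rewrite Uj, Cj, comp_idr; symmetry; apply alg_act_unit.
    + apply (binary_coproduct_eq Hs); rewrite <- !comp_assoc.
      * rewrite Ui, Ci; crw E2; rewrite Eb, (fmap_comp T); reflexivity.
      * rewrite Uj, Cj, comp_idr; symmetry; apply alg_act_unit.
  - exists d; rewrite <- V1, <- V2, <- D, <- M1, <- M2, !comp_assoc; auto.
Qed.

Lemma reflexive_relation_algebra (X : category) (T : monad X) (x : algebra T)
    (r : span (alg_ob x)) (d : hom (T (sp_ob r)) (sp_ob r)) :
  jointly_monic r ->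
  sp_fst r ∘ d = alg_act x ∘ fmap T (sp_fst r) ->
  sp_snd r ∘ d = alg_act x ∘ fmap T (sp_snd r) ->
  d ∘ m_unit T (sp_ob r) = idm (sp_ob r) /\
  d ∘ m_mult T (sp_ob r) = d ∘ fmap T d.
Proof.
  intros jm D1 D2; split.
  - apply jm; rewrite comp_assoc, ?D1, ?D2, <- comp_assoc, comp_idr;
      apply alg_act_unit.
  - assert (N : forall k : hom (sp_ob r) (alg_ob x), k ∘ d = alg_act x ∘ fmap T k ->
              k ∘ (d ∘ m_mult T (sp_ob r)) = k ∘ (d ∘ fmap T d)).
    { intros k D; rewrite !comp_assoc, D, <- !comp_assoc.
      transitivity (alg_act x ∘ (m_mult T (alg_ob x) ∘ fmap T (fmap T k))).
      - f_equal; exact (eq_sym (naturality (m_mult T) k)).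
      - rewrite comp_assoc, alg_mult, <- comp_assoc, <- !(fmap_comp T), D; reflexivity. }
    apply jm; apply N; assumption.
Qed.

(** Ontoness is the point: a reflexive relation on [U a] carries an algebra structure,
    hence is isomorphic to [U] of some object of [A], and its projections, being algebra
    morphisms, lift to [A]. *)
Lemma rrel_apply_correspondence (A X : category) (U : functor A X) (F : left_adjoint U)
    (a : A) :
  monadic F -> has_finite_limits X -> has_finite_coproducts X ->
  essentially_nullary (induced_monad F) -> correspondence (@rrel_apply A X U a).
Proof.
  intros mon lim cop nul; split.
  - intros r; destruct (rrel_apply_total F r) as [s H]; exists r, s.
    split; [apply (rep_iso_refl (RRel_ordered a)) | exact H].
  - intros [s Hs].
    destruct (@reflexive_relation_subalgebra _ _ (comparison_ob F a) s lim cop nul Hs)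
      as (d & D1 & D2).
    destruct (@reflexive_relation_algebra _ _ (comparison_ob F a) s d (proj1 Hs) D1 D2)
      as [Y1 Y2].
    destruct (monadic_algebra mon (Algebra Y1 Y2)) as (r & h & iso & Eh); simpl in *.
    assert (lift : forall k : hom (sp_ob s) (U a),
      k ∘ d = fmap U (la_counit F a) ∘ fmap U (fmap F k) ->
      exists f : hom r a, fmap U f = k ∘ h).
    { intros k Ek; apply (monadic_full mon); simpl.
      crw Eh; crw Ek; rewrite !(fmap_comp F), !(fmap_comp U); reflexivity. }
    destruct (lift _ D1) as [r1 R1], (lift _ D2) as [r2 R2].
    pose (R := Span r1 r2).
    pose proof (@iso_mono _ _ _ _ iso) as mono; destruct Hs as [js es].
    assert (jm : jointly_monic R).
    { intros t f g E1 E2; apply (monadic_faithful mon), mono, js; rewrite !comp_assoc.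
      - rewrite <- R1, <- !(fmap_comp U); f_equal; exact E1.
      - rewrite <- R2, <- !(fmap_comp U); f_equal; exact E2. }
    destruct iso as (h' & H1 & H2).
    assert (incl : span_incl s (map_span U R)).
    { exists h'; simpl; rewrite R1, R2, <- !comp_assoc, H2, !comp_idr; auto. }
    assert (refl : reflexive R).
    { apply (related_map_span mon (f := idm a) (g := idm a) jm); rewrite !(fmap_id U).
      apply (proj1 (span_incl_related _ _) incl), reflexive_related, es. }
    pose proof (map_span_reflexive_relation F (conj jm refl)) as HR.
    exists (exist _ _ HR), (exist _ R (conj jm refl)); split; [|reflexivity].
    apply (span_iso_incl js (proj1 HR)); split; [exact incl|].
    exists h; simpl; auto.
  - intros [r Hr] [s Hs] [r' Hr'] [s' Hs'] E E'; unfold rrel_apply in *; simpl in *.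
    subst s s'; apply (span_incl_map_span mon), Hr'.
Qed.

(** Meets and joins start from reflexive relations on [U a] (index 4 in the proof, the
    collections being numbered in the order quotients, equivalence relations and
    reflexive relations on [a], reflexive relations, equivalence relations, quotients and
    normal subobjects on [U a]) and propagate from neighbour to neighbour. *)
Lemma monadic_lattices (A X : category) (U : functor A X) (F : left_adjoint U) :
  barr_exact A -> semi_abelian X -> monadic F ->
  essentially_nullary (induced_monad F) ->
  forall a : A, lattices_canonically_isomorphic U a.
Proof.
  intros exA sab mon nul a.
  pose proof sab as (Z & exX & pm & cop).
  pose proof exX as [regX _]; pose proof regX as [limX _].
  pose proof (regular_has_pullbacks regX) as pbX.
  pose proof (regular_has_pullbacks (proj1 exA)) as pbA.
  assert (malX : maltsev_at (U a)) by (intros r; apply protomodular_maltsev; assumption).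
  pose proof (monadic_maltsev mon pbX malX) as malA.
  pose proof (Quot_ordered a pbA) as O1; pose proof (ERel_ordered a) as O2.
  pose proof (RRel_ordered a) as O3; pose proof (RRel_ordered (U a)) as O4.
  pose proof (ERel_ordered (U a)) as O5; pose proof (Quot_ordered (U a) pbX) as O6.
  pose proof (NSub_ordered (U a)) as O7.
  pose proof (quot_erel_correspondence a exA) as c12.
  pose proof (erel_rrel_correspondence malA) as c23.
  pose proof (rrel_apply_correspondence a mon limX cop nul) as c34.
  pose proof (erel_rrel_correspondence malX) as c54.
  pose proof (quot_erel_correspondence (U a) exX) as c65.
  pose proof (quot_nsub_correspondence (U a) sab) as c67.
  pose proof (correspondence_flip c12) as c21; pose proof (correspondence_flip c23) as c32.
  pose proof (correspondence_flip c34) as c43; pose proof (correspondence_flip c54) as c45.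
  pose proof (correspondence_flip c65) as c56.
  pose proof (RRel_meets (y := U a) limX) as m4; pose proof (RRel_joins regX malX) as j4.
  pose proof (correspondence_meets O4 O3 c43 m4) as m3.
  pose proof (correspondence_joins O4 O3 c43 j4) as j3.
  pose proof (correspondence_meets O3 O2 c32 m3) as m2.
  pose proof (correspondence_joins O3 O2 c32 j3) as j2.
  pose proof (correspondence_meets O4 O5 c45 m4) as m5.
  pose proof (correspondence_joins O4 O5 c45 j4) as j5.
  pose proof (correspondence_meets O5 O6 c56 m5) as m6.
  pose proof (correspondence_joins O5 O6 c56 j5) as j6.
  split; try (apply ordered_lattice; assumption).
  - apply ordered_lattice; [exact O1 | exact (correspondence_meets O2 O1 c21 m2)
                            | exact (correspondence_joins O2 O1 c21 j2)].
  - apply ordered_lattice; [exact O7 | exact (correspondence_meets O6 O7 c67 m6)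
                            | exact (correspondence_joins O6 O7 c67 j6)].
  - apply correspondence_induces; auto; intros q; exact (quot_erel_total q pbA).
  - apply correspondence_induces; auto; apply erel_rrel_total.
  - apply correspondence_induces; auto; exact (rrel_apply_total F (a := a)).
  - apply correspondence_induces; auto; apply erel_rrel_total.
  - apply correspondence_induces; auto; intros q; exact (quot_erel_total q pbX).
  - apply correspondence_induces; auto; intros q; exact (quot_nsub_total q Z pbX).
Qed.

(** * Exactness properties of slice categories *)

Lemma pullback_intro (C : category) (x y z p : C) (f : hom x z) (g : hom y z)
    (p1 : hom p x) (p2 : hom p y) :
  f ∘ p1 = g ∘ p2 ->
  (forall (t : C) (h : hom t x) (k : hom t y), f ∘ h = g ∘ k ->
     exists u : hom t p, p1 ∘ u = h /\ p2 ∘ u = k) ->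
  (forall (t : C) (u v : hom t p), p1 ∘ u = p1 ∘ v -> p2 ∘ u = p2 ∘ v -> u = v) ->
  is_pullback f g p1 p2.
Proof.
  intros sq ex uniq; split; [exact sq|]; intros t h k E.
  destruct (ex t h k E) as (u & <- & <-); exists u; split; [auto|].
  intros v [V1 V2]; apply uniq; auto.
Qed.

Section Slice.
Variables (C : category) (b : C).

Lemma slice_iso (x y : slice b) (f : hom x y) : is_iso (sh_mor f) -> is_iso f.
Proof.
  intros (g & E1 & E2).
  unshelve eexists (@SliceHom C b y x g _).
  - rewrite <- (sh_map f); crw E2; reflexivity.
  - split; apply slice_hom_eq; assumption.
Qed.

Lemma slice_mono (x y : slice b) (f : hom x y) : is_mono f -> is_mono (sh_mor f).
Proof.
  intros mono t u v E.
  assert (Ev : so_map x ∘ v = so_map x ∘ u).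
  { rewrite <- (sh_map f), <- !comp_assoc, E; reflexivity. }
  refine (f_equal (@sh_mor _ _ _ _)
    (mono (SliceOb (so_map x ∘ u)) (@SliceHom C b (SliceOb (so_map x ∘ u)) x u eq_refl)
       (@SliceHom C b (SliceOb (so_map x ∘ u)) x v Ev) _)).
  apply slice_hom_eq; exact E.
Qed.

Lemma slice_pullback (x y z p : slice b) (f : hom x z) (g : hom y z)
    (p1 : hom p x) (p2 : hom p y) :
  is_pullback f g p1 p2 <->
  is_pullback (sh_mor f) (sh_mor g) (sh_mor p1) (sh_mor p2).
Proof.
  split.
  - intros [sq univ].
    assert (lift : forall t (h : hom t (so_ob x)) (k : hom t (so_ob y)),
      sh_mor f ∘ h = sh_mor g ∘ k ->
      exists! u : slice_hom (SliceOb (so_map x ∘ h)) p,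
        sh_mor p1 ∘ sh_mor u = h /\ sh_mor p2 ∘ sh_mor u = k).
    { intros t h k E.
      assert (Ek : so_map y ∘ k = so_map x ∘ h).
      { rewrite <- (sh_map f), <- (sh_map g), <- !comp_assoc, E; reflexivity. }
      destruct (univ (SliceOb (so_map x ∘ h))
        (@SliceHom C b (SliceOb (so_map x ∘ h)) x h eq_refl)
        (@SliceHom C b (SliceOb (so_map x ∘ h)) y k Ek)) as (u & [U1 U2] & uniq).
      - apply slice_hom_eq; exact E.
      - exists u; split.
        + split; [exact (f_equal (@sh_mor _ _ _ _) U1) | exact (f_equal (@sh_mor _ _ _ _) U2)].
        + intros v [V1 V2]; apply uniq; split; apply slice_hom_eq; assumption. }
    assert (sq' : sh_mor f ∘ sh_mor p1 = sh_mor g ∘ sh_mor p2)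
      by exact (f_equal (@sh_mor _ _ _ _) sq).
    split; [exact sq'|]; intros t h k E.
    destruct (lift t h k E) as (u & [U1 U2] & uniq); exists (sh_mor u).
    split; [auto|]; intros v [V1 V2].
    assert (Ev : so_map p ∘ v = so_map x ∘ h).
    { rewrite <- V1, comp_assoc, (sh_map p1); reflexivity. }
    exact (f_equal (@sh_mor _ _ _ _)
      (uniq (@SliceHom C b (SliceOb (so_map x ∘ h)) p v Ev) (conj V1 V2))).
  - intros pb; apply pullback_intro.
    + apply slice_hom_eq; exact (proj1 pb).
    + intros t h k E.
      destruct (proj2 pb _ (sh_mor h) (sh_mor k) (f_equal (@sh_mor _ _ _ _) E))
        as (u & [U1 U2] & _).
      unshelve eexists (@SliceHom C b t p u _).
      * rewrite <- (sh_map p1), <- comp_assoc, U1; apply sh_map.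
      * split; apply slice_hom_eq; assumption.
    + intros t u v E1 E2; apply slice_hom_eq, (pullback_eq pb).
      * exact (f_equal (@sh_mor _ _ _ _) E1).
      * exact (f_equal (@sh_mor _ _ _ _) E2).
Qed.

(** Coequalizers are computed in [C], as the forgetful functor has the right adjoint
    [a |-> a * b]. *)
Lemma slice_regular_epi (x y : slice b) (e : hom x y) :
  has_products C -> (is_regular_epi e <-> is_regular_epi (sh_mor e)).
Proof.
  intros prods; split.
  - intros (w & f & g & sq & univ).
    exists (so_ob w), (sh_mor f), (sh_mor g).
    split; [exact (f_equal (@sh_mor _ _ _ _) sq)|]; intros t h E.
    destruct (prods t b) as (tb & p1 & p2 & prod).
    destruct (prod _ h (so_map x)) as (k & [K1 K2] & _).
    destruct (univ (SliceOb p2) (@SliceHom C b x (SliceOb p2) k K2)) as (u & Eu & uniq).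
    { apply slice_hom_eq, (product_eq prod); simpl.
      - rewrite !comp_assoc, K1; exact E.
      - rewrite !comp_assoc, K2, !sh_map; reflexivity. }
    apply (f_equal (@sh_mor _ _ _ _)) in Eu; simpl in Eu.
    exists (p1 ∘ sh_mor u); split; [rewrite <- comp_assoc, Eu; exact K1|].
    intros v Ev; destruct (prod _ v (so_map y)) as (v' & [V1 V2] & _).
    rewrite <- V1; f_equal.
    refine (f_equal (@sh_mor _ _ _ _) (uniq (@SliceHom C b y (SliceOb p2) v' V2) _)).
    apply slice_hom_eq, (product_eq prod); simpl.
    + rewrite comp_assoc, V1, K1; exact Ev.
    + rewrite comp_assoc, V2, K2; apply sh_map.
  - intros (w & f & g & sq & univ).
    assert (Eg : so_map x ∘ g = so_map x ∘ f).
    { rewrite <- (sh_map e), <- !comp_assoc, sq; reflexivity. }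
    pose (w' := SliceOb (so_map x ∘ f)).
    exists w', (@SliceHom C b w' x f eq_refl), (@SliceHom C b w' x g Eg).
    split; [apply slice_hom_eq; exact sq|]; intros t h E.
    destruct (univ _ (sh_mor h) (f_equal (@sh_mor _ _ _ _) E)) as (u & Eu & uniq).
    unshelve eexists (@SliceHom C b y t u _).
    + apply (coequalizer_epi (conj sq univ)).
      rewrite <- comp_assoc, Eu, !sh_map; reflexivity.
    + split; [apply slice_hom_eq; exact Eu|]; intros v Ev; apply slice_hom_eq, uniq.
      exact (f_equal (@sh_mor _ _ _ _) Ev).
Qed.

Lemma slice_regular : is_regular C -> is_regular (slice b).
Proof.
  intros reg; pose proof reg as (lim & coeq & stable).
  pose proof (finite_limits_products lim) as prods.
  split; [exact (slice_finite_limits lim)|]; split.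
  - intros x y r f r1 r2 H; apply slice_pullback in H.
    destruct (coeq _ _ _ _ _ _ H) as (q & e & He).
    destruct (proj2 He _ (so_map x)) as (qb & Eq & _).
    { rewrite !sh_map; reflexivity. }
    pose proof (coequalizer_epi He) as epi.
    exists (SliceOb qb), (@SliceHom C b x (SliceOb qb) e Eq).
    split; [apply slice_hom_eq; exact (proj1 He)|]; intros t h E.
    destruct (proj2 He _ (sh_mor h) (f_equal (@sh_mor _ _ _ _) E)) as (u & Eu & uniq).
    unshelve eexists (@SliceHom C b (SliceOb qb) t u _).
    + simpl; apply epi; rewrite <- comp_assoc, Eu, sh_map; symmetry; exact Eq.
    + split; [apply slice_hom_eq; exact Eu|]; intros v Ev; apply slice_hom_eq, uniq.
      exact (f_equal (@sh_mor _ _ _ _) Ev).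
  - intros x y z p f g p1 p2 H; apply slice_pullback in H.
    rewrite !slice_regular_epi by exact prods; exact (stable _ _ _ _ _ _ _ _ H).
Qed.

Lemma slice_span_jointly_monic (y : slice b) (r : span y) :
  jointly_monic r ->
  jointly_monic (@Span C (so_ob y) (so_ob (sp_ob r)) (sh_mor (sp_fst r)) (sh_mor (sp_snd r))).
Proof.
  intros jm t u v E1 E2; simpl in *.
  assert (Ev : so_map (sp_ob r) ∘ v = so_map (sp_ob r) ∘ u).
  { rewrite <- (sh_map (sp_fst r)), <- !comp_assoc, E1; reflexivity. }
  refine (f_equal (@sh_mor _ _ _ _) (jm (SliceOb (so_map (sp_ob r) ∘ u))
    (@SliceHom C b (SliceOb (so_map (sp_ob r) ∘ u)) (sp_ob r) u eq_refl)
    (@SliceHom C b (SliceOb (so_map (sp_ob r) ∘ u)) (sp_ob r) v Ev) _ _));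
    apply slice_hom_eq; assumption.
Qed.

Lemma slice_barr_exact : barr_exact C -> barr_exact (slice b).
Proof.
  intros [reg eff]; split; [exact (slice_regular reg)|].
  intros y r (jm & (e & E1 & E2) & (s & S1 & S2) & tr).
  pose (r' := @Span C (so_ob y) (so_ob (sp_ob r)) (sh_mor (sp_fst r)) (sh_mor (sp_snd r))).
  assert (eq' : is_equivalence_relation r').
  { split; [exact (slice_span_jointly_monic jm)|]; split; [|split].
    - exists (sh_mor e); split;
        [exact (f_equal (@sh_mor _ _ _ _) E1) | exact (f_equal (@sh_mor _ _ _ _) E2)].
    - exists (sh_mor s); split;
        [exact (f_equal (@sh_mor _ _ _ _) S1) | exact (f_equal (@sh_mor _ _ _ _) S2)].
    - intros p p1 p2 pb.
      pose (p' := SliceOb (so_map (sp_ob r) ∘ p1)).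
      assert (Ep : so_map (sp_ob r) ∘ p2 = so_map (sp_ob r) ∘ p1).
      { transitivity (so_map y ∘ (sh_mor (sp_fst r) ∘ p2)).
        - rewrite comp_assoc, sh_map; reflexivity.
        - transitivity (so_map y ∘ (sh_mor (sp_snd r) ∘ p1)).
          + f_equal; exact (eq_sym (proj1 pb)).
          + rewrite comp_assoc, sh_map; reflexivity. }
      destruct (tr p' (@SliceHom C b p' (sp_ob r) p1 eq_refl)
                  (@SliceHom C b p' (sp_ob r) p2 Ep)) as (t & T1 & T2).
      + apply slice_pullback; exact pb.
      + exists (sh_mor t); split;
          [exact (f_equal (@sh_mor _ _ _ _) T1) | exact (f_equal (@sh_mor _ _ _ _) T2)]. }
  destruct (eff _ _ eq') as (z & f & Hf).
  (* [f] need not live over [b], but [(f, y -> b)] does; it has the same kernel pair,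
     since [r] only relates elements with the same image in [b]. *)
  destruct (finite_limits_products (proj1 reg) z b) as (zb & p1 & p2 & prod).
  destruct (prod _ f (so_map y)) as (g & [G1 G2] & _).
  exists (SliceOb p2), (@SliceHom C b y (SliceOb p2) g G2).
  apply slice_pullback; simpl.
  apply (@kernel_pair_intro C (so_ob y) zb g r'); [exact (kernel_pair_jointly_monic Hf)|].
  intros t u v; split.
  - intros H; apply (product_eq prod).
    + rewrite !comp_assoc, G1; apply (kernel_pair_related Hf); exact H.
    + rewrite !comp_assoc, G2; destruct H as (c & <- & <-); simpl.
      rewrite !comp_assoc, !sh_map; reflexivity.
  - intros E; apply (kernel_pair_related Hf); rewrite <- G1, <- !comp_assoc, E; reflexivity.
Qed.

Definition slice_pullback_choice (P : pullback_choice C) : pullback_choice (slice b).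
Proof.
  intros x y z f g.
  pose (Q := P _ _ _ (sh_mor f) (sh_mor g)).
  pose (p := SliceOb (so_map x ∘ pb_fst Q) : slice b).
  assert (E2 : so_map y ∘ pb_snd Q = so_map x ∘ pb_fst Q).
  { rewrite <- (sh_map f), <- (sh_map g), <- !comp_assoc, (proj1 (pb_spec Q)); reflexivity. }
  pose (p1 := @SliceHom C b p x (pb_fst Q) eq_refl : hom p x).
  pose (p2 := @SliceHom C b p y (pb_snd Q) E2 : hom p y).
  assert (pair : forall t (h : hom t x) (k : hom t y), f ∘ h = g ∘ k ->
            { u : hom t p | p1 ∘ u = h /\ p2 ∘ u = k }).
  { intros t h k E; pose (E' := f_equal (@sh_mor _ _ _ _) E); simpl in E'.
    unshelve eexists (@SliceHom C b t p (pb_pair Q E') _).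
    - simpl; rewrite <- comp_assoc, pb_pair_fst; apply sh_map.
    - split; apply slice_hom_eq; simpl; [apply pb_pair_fst | apply pb_pair_snd]. }
  refine (@ChosenPullback (slice b) x y z f g p p1 p2 _
            (fun t h k E => proj1_sig (pair t h k E)) _ _).
  - apply slice_pullback; exact (pb_spec Q).
  - intros t h k E; apply (proj2_sig (pair t h k E)).
  - intros t h k E; apply (proj2_sig (pair t h k E)).
Defined.

Lemma slice_protomodular : protomodular C -> protomodular (slice b).
Proof.
  intros pm; pose proof (protomodular_reflects_isos_over pm) as refl.
  destruct pm as [P _]; apply (reflects_isos_over_protomodular (slice_pullback_choice P)).
  intros b1 b0 v p q f Hf; apply slice_iso.
  pose (p' := Point (f_equal (@sh_mor _ _ _ _) (pt_split p)) : point (so_ob b0)).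
  pose (q' := Point (f_equal (@sh_mor _ _ _ _) (pt_split q)) : point (so_ob b0)).
  apply (refl _ _ (sh_mor v) p' q' (@PointHom C _ p' q' (sh_mor (ph_mor f))
    (f_equal (@sh_mor _ _ _ _) (ph_proj f)) (f_equal (@sh_mor _ _ _ _) (ph_sect f)))).
  intros t a k E; simpl in *.
  pose (t' := SliceOb (so_map b1 ∘ k)).
  assert (Ea : so_map (pt_ob q) ∘ a = so_map b1 ∘ k).
  { rewrite <- (sh_map (pt_proj q)), <- (sh_map v), <- !comp_assoc, E; reflexivity. }
  destruct (Hf t' (@SliceHom C b t' (pt_ob q) a Ea) (@SliceHom C b t' b1 k eq_refl))
    as (c & Ec & uniq).
  - apply slice_hom_eq; exact E.
  - apply (f_equal (@sh_mor _ _ _ _)) in Ec; simpl in Ec.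
    exists (sh_mor c); split; [exact Ec|]; intros d Ed.
    assert (Eb : so_map (pt_ob p) ∘ d = so_map b1 ∘ k).
    { rewrite <- (sh_map (ph_mor f)), <- comp_assoc, Ed; exact Ea. }
    refine (f_equal (@sh_mor _ _ _ _) (uniq (@SliceHom C b t' (pt_ob p) d Eb) _)).
    apply slice_hom_eq; exact Ed.
Qed.

Lemma slice_finite_coproducts : has_finite_coproducts C -> has_finite_coproducts (slice b).
Proof.
  intros cop I x fin.
  destruct (cop I (fun i => so_ob (x i)) fin) as (s & inj & H).
  destruct (H b (fun i => so_map (x i))) as (sb & Es & uniqs).
  exists (SliceOb sb), (fun i => @SliceHom C b (x i) (SliceOb sb) (inj i) (Es i)).
  intros t f; destruct (H (so_ob t) (fun i => sh_mor (f i))) as (u & Eu & uniq).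
  unshelve eexists (@SliceHom C b (SliceOb sb) t u _).
  - simpl; symmetry; apply uniqs; intros i; rewrite <- comp_assoc, Eu; apply sh_map.
  - split; [intros i; apply slice_hom_eq, Eu|]; intros v Ev; apply slice_hom_eq, uniq.
    intros i; exact (f_equal (@sh_mor _ _ _ _) (Ev i)).
Qed.

Lemma slice_zero_object : is_initial b -> is_zero_object (SliceOb (idm b) : slice b).
Proof.
  intros ini; split; intros x.
  - destruct (ini (so_ob x)) as (u & _ & _).
    exists (@SliceHom C b (SliceOb (idm b)) x u (exists_unique_eq (ini b) I I)).
    split; [exact I|]; intros v _; apply slice_hom_eq; exact (exists_unique_eq (ini _) I I).
  - exists (@SliceHom C b x (SliceOb (idm b)) (so_map x) (comp_idl _)).
    split; [exact I|]; intros v _; apply slice_hom_eq; simpl.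
    rewrite <- (sh_map v); apply comp_idl.
Qed.

End Slice.

(** * Multiplication by an object as a functor to the slice *)

(** Products with [b] as chosen structure, since [a |-> a * b] has to be a functor. *)
Record products_with (C : category) (b : C) := ProductsWith {
  pw_ob : C -> C;
  pw_fst : forall a, hom (pw_ob a) a;
  pw_snd : forall a, hom (pw_ob a) b;
  pw_pair : forall a t, hom t a -> hom t b -> hom t (pw_ob a);
  pw_pair_fst : forall a t (f : hom t a) (g : hom t b), pw_fst a ∘ pw_pair f g = f;
  pw_pair_snd : forall a t (f : hom t a) (g : hom t b), pw_snd a ∘ pw_pair f g = g;
  pw_eq : forall a t (u v : hom t (pw_ob a)),
    pw_fst a ∘ u = pw_fst a ∘ v -> pw_snd a ∘ u = pw_snd a ∘ v -> u = v
}.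

Lemma products_with_exist (C : category) (b : C) :
  has_products C -> exists P : products_with b, True.
Proof.
  intros prods.
  assert (S : forall a, { p : C & { p1 : hom p a & { p2 : hom p b | is_product p1 p2 }}}).
  { intros a; destruct (constructive_indefinite_description _ (prods a b)) as [p H].
    exists p; destruct (constructive_indefinite_description _ H) as [p1 H1].
    exists p1; exact (constructive_indefinite_description _ H1). }
  assert (T : forall a t (f : hom t a) (g : hom t b),
    { u | projT1 (projT2 (S a)) ∘ u = f /\ proj1_sig (projT2 (projT2 (S a))) ∘ u = g }).
  { intros a t f g; apply constructive_indefinite_description.
    destruct (proj2_sig (projT2 (projT2 (S a))) t f g) as (u & E & _); exists u; exact E. }
  unshelve eexists (@ProductsWith C b (fun a => projT1 (S a))
    (fun a => projT1 (projT2 (S a))) (fun a => proj1_sig (projT2 (projT2 (S a))))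
    (fun a t f g => proj1_sig (T a t f g)) _ _ _); [| | |exact I].
  - intros a t f g; apply (proj2_sig (T a t f g)).
  - intros a t f g; apply (proj2_sig (T a t f g)).
  - intros a t u v; apply (product_eq (proj2_sig (projT2 (projT2 (S a))))).
Qed.

Section ProductFunctor.
Variables (C : category) (b : C) (P : products_with b).

Definition pw_map (x y : C) (f : hom x y) : hom (pw_ob P x) (pw_ob P y) :=
  pw_pair P (f ∘ pw_fst P x) (pw_snd P x).

Lemma pw_map_fst (x y : C) (f : hom x y) : pw_fst P y ∘ pw_map f = f ∘ pw_fst P x.
Proof. apply pw_pair_fst. Qed.

Lemma pw_map_snd (x y : C) (f : hom x y) : pw_snd P y ∘ pw_map f = pw_snd P x.
Proof. apply pw_pair_snd. Qed.

Definition product_functor : functor C (slice b).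
Proof.
  refine (@Functor C (slice b) (fun a => SliceOb (pw_snd P a))
    (fun x y f => @SliceHom C b (SliceOb (pw_snd P x)) (SliceOb (pw_snd P y))
                    (pw_map f) (pw_map_snd f)) _ _).
  - intros x; apply slice_hom_eq, (pw_eq (p := P)); simpl.
    + rewrite pw_map_fst, comp_idl, comp_idr; reflexivity.
    + rewrite pw_map_snd, comp_idr; reflexivity.
  - intros x y z g f; apply slice_hom_eq, (pw_eq (p := P)); simpl.
    + rewrite pw_map_fst; crw (pw_map_fst g); crw (pw_map_fst f); reflexivity.
    + rewrite pw_map_snd; crw (pw_map_snd g); crw (pw_map_snd f); reflexivity.
Defined.

Definition product_unit :
  nat_trans (id_functor (slice b)) (comp_functor product_functor (slice_forget b)).
Proof.
  refine (@NatTrans _ _ (id_functor (slice b)) (comp_functor product_functor (slice_forget b))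
    (fun x => @SliceHom C b x (SliceOb (pw_snd P (so_ob x)))
                (pw_pair P (idm (so_ob x)) (so_map x)) (pw_pair_snd P _ _)) _).
  intros x y f; apply slice_hom_eq, (pw_eq (p := P)); simpl.
  - crw (pw_map_fst (sh_mor f)); rewrite pw_pair_fst.
    rewrite comp_assoc, pw_pair_fst, comp_idl, comp_idr; reflexivity.
  - crw (pw_map_snd (sh_mor f)); rewrite pw_pair_snd, comp_assoc, pw_pair_snd; apply sh_map.
Defined.

Definition product_counit :
  nat_trans (comp_functor (slice_forget b) product_functor) (id_functor C).
Proof.
  refine (@NatTrans _ _ (comp_functor (slice_forget b) product_functor) (id_functor C)
            (pw_fst P) _).
  intros x y f; apply pw_map_fst.
Defined.

Definition product_adjoint : left_adjoint product_functor.
Proof.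
  refine (@LeftAdjoint C (slice b) product_functor (slice_forget b)
            product_unit product_counit _ _).
  - intros x; apply pw_pair_fst.
  - intros a; apply slice_hom_eq, (pw_eq (p := P)); simpl.
    + rewrite comp_assoc, pw_map_fst, <- comp_assoc, pw_pair_fst; reflexivity.
    + rewrite comp_assoc, pw_map_snd, pw_pair_snd; symmetry; apply comp_idr.
Defined.

Let T := induced_monad product_adjoint.

(** Hence [- * b] preserves every property of morphisms that is stable under
    pullback. *)
Lemma pw_map_pullback (x y : C) (f : hom x y) :
  is_pullback f (pw_fst P y) (pw_fst P x) (pw_map f).
Proof.
  apply pullback_intro.
  - symmetry; apply pw_map_fst.
  - intros t h k E; exists (pw_pair P h (pw_snd P y ∘ k)).
    split; [apply pw_pair_fst|]; apply (pw_eq (p := P)).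
    + crw (pw_map_fst f); rewrite pw_pair_fst; exact E.
    + crw (pw_map_snd f); apply pw_pair_snd.
  - intros t u v E1 E2; apply (pw_eq (p := P)); [exact E1|].
    rewrite <- (pw_map_snd f), <- !comp_assoc, E2; reflexivity.
Qed.

Lemma product_monad_pullbacks : preserves_pullbacks T.
Proof.
  intros x y z p f g p1 p2 pb; apply slice_pullback in pb; apply slice_pullback; simpl.
  apply pullback_intro.
  - apply (pw_eq (p := P)).
    + crw (pw_map_fst (sh_mor f)); crw (pw_map_fst (sh_mor g)).
      rewrite !pw_map_fst, !comp_assoc, (proj1 pb); reflexivity.
    + crw (pw_map_snd (sh_mor f)); crw (pw_map_snd (sh_mor g)).
      rewrite !pw_map_snd; reflexivity.
  - intros t h k E.
    destruct (proj2 pb t (pw_fst P _ ∘ h) (pw_fst P _ ∘ k)) as (u & [U1 U2] & _).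
    { rewrite !comp_assoc, <- (pw_map_fst (sh_mor f)), <- (pw_map_fst (sh_mor g)).
      rewrite <- !comp_assoc, E; reflexivity. }
    assert (E' : pw_snd P _ ∘ h = pw_snd P _ ∘ k).
    { rewrite <- (pw_map_snd (sh_mor f)), <- (pw_map_snd (sh_mor g)), <- !comp_assoc, E.
      reflexivity. }
    exists (pw_pair P u (pw_snd P _ ∘ h)); split; apply (pw_eq (p := P)).
    + crw (pw_map_fst (sh_mor p1)); rewrite pw_pair_fst; exact U1.
    + crw (pw_map_snd (sh_mor p1)); apply pw_pair_snd.
    + crw (pw_map_fst (sh_mor p2)); rewrite pw_pair_fst; exact U2.
    + crw (pw_map_snd (sh_mor p2)); rewrite pw_pair_snd; exact E'.
  - intros t u v E1 E2; apply (pw_eq (p := P)).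
    + apply (pullback_eq pb); rewrite !comp_assoc, <- !pw_map_fst, <- !comp_assoc, ?E1, ?E2;
        reflexivity.
    + rewrite <- (pw_map_snd (sh_mor p1)), <- !comp_assoc, E1; reflexivity.
Qed.

Lemma product_monad_cartesian : cartesian_monad T.
Proof.
  split; [exact product_monad_pullbacks|]; split; intros x y f; apply slice_pullback; simpl.
  - apply pullback_intro.
    + exact (eq_sym (f_equal (@sh_mor _ _ _ _) (naturality product_unit f))).
    + intros t h k E.
      assert (E1 : sh_mor f ∘ (pw_fst P _ ∘ h) = k).
      { rewrite comp_assoc, <- pw_map_fst, <- comp_assoc, E, comp_assoc, pw_pair_fst.
        apply comp_idl. }
      exists (pw_fst P _ ∘ h); split; [|exact E1].
      apply (pw_eq (p := P)).
      * rewrite comp_assoc, pw_pair_fst; apply comp_idl.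
      * rewrite comp_assoc, pw_pair_snd, <- (sh_map f), <- comp_assoc, E1.
        rewrite <- (pw_map_snd (sh_mor f)), <- comp_assoc, E, comp_assoc, pw_pair_snd.
        reflexivity.
    + intros t u v E _.
      rewrite <- (comp_idl u), <- (comp_idl v), <- (pw_pair_fst P (idm _) (so_map x)).
      rewrite <- !comp_assoc, E; reflexivity.
  - apply pullback_intro.
    + exact (eq_sym (f_equal (@sh_mor _ _ _ _) (naturality (m_mult T) f))).
    + intros t h k E.
      assert (E1 : pw_fst P _ ∘ (pw_fst P _ ∘ k) = sh_mor f ∘ (pw_fst P _ ∘ h)).
      { rewrite !comp_assoc, <- !pw_map_fst, <- !comp_assoc, E; reflexivity. }
      assert (E2 : pw_snd P _ ∘ k = pw_snd P _ ∘ h).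
      { rewrite <- (pw_map_snd (sh_mor f)), <- comp_assoc, E, comp_assoc, pw_map_snd.
        reflexivity. }
      exists (pw_pair P (pw_pair P (pw_fst P _ ∘ h) (pw_snd P _ ∘ (pw_fst P _ ∘ k)))
                (pw_snd P _ ∘ h)); split; apply (pw_eq (p := P)).
      * rewrite comp_assoc, pw_map_fst, <- comp_assoc, !pw_pair_fst; reflexivity.
      * rewrite comp_assoc, pw_map_snd, pw_pair_snd; reflexivity.
      * rewrite comp_assoc, pw_map_fst, <- comp_assoc, pw_pair_fst.
        apply (pw_eq (p := P)).
        -- rewrite comp_assoc, pw_map_fst, <- comp_assoc, pw_pair_fst; symmetry; exact E1.
        -- rewrite comp_assoc, pw_map_snd, pw_pair_snd; reflexivity.
      * rewrite comp_assoc, pw_map_snd, pw_pair_snd; symmetry; exact E2.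
    + intros t u v E1 E2; apply (pw_eq (p := P)); [apply (pw_eq (p := P))|].
      * rewrite !comp_assoc, <- !pw_map_fst, <- !comp_assoc, E1; reflexivity.
      * assert (K : forall w, pw_snd P _ ∘ (pw_fst P _ ∘ w) =
                  pw_snd P _ ∘ (pw_fst P _ ∘ (pw_map (pw_map (sh_mor f)) ∘ w : hom t _))).
        { intros w; symmetry; rewrite (comp_assoc (pw_fst P _)), pw_map_fst, <- comp_assoc.
          rewrite (comp_assoc (pw_snd P _)), pw_map_snd; reflexivity. }
        rewrite !K, E2; reflexivity.
      * rewrite <- (pw_map_snd (pw_fst P (so_ob x))), <- !comp_assoc, E1; reflexivity.
Qed.

Lemma product_monad_regular_epis : is_regular C -> preserves_regular_epis T.
Proof.
  intros reg x y e; pose proof (finite_limits_products (proj1 reg)) as prods.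
  rewrite !slice_regular_epi by exact prods; simpl.
  apply (proj2 (proj2 reg) _ _ _ _ _ _ _ _ (pw_map_pullback (sh_mor e))).
Qed.

End ProductFunctor.

(** Equalizers are monomorphisms, which gives that [e] is epic, and so is the pullback
    along [v] of a monomorphism through which [v e] factors, which gives the
    diagonal. *)
Lemma extremal_strong_epi (C : category) (x y : C) (e : hom x y) :
  has_finite_limits C ->
  (forall (w : C) (n : hom w y), is_mono n -> (exists e', n ∘ e' = e) -> is_iso n) ->
  is_strong_epi e.
Proof.
  intros lim ext; pose proof (finite_limits_pullbacks lim) as pbs.
  assert (epi : is_epi e).
  { intros t f g E.
    destruct (@related_subobject C t (Span (idm t) (idm t)) y f g
                (finite_limits_products lim) pbs) as (w & m & mono & Hm).
    { intros u a b E' _; simpl in E'; rewrite !comp_idl in E'; exact E'. }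
    destruct (ext _ m mono) as (m' & _ & M).
    { apply Hm; exists (f ∘ e); simpl; rewrite !comp_idl; auto. }
    destruct (proj1 (Hm _ (idm y))) as (c & C1 & C2); [exists m'; exact M|].
    simpl in C1, C2; rewrite comp_idl, comp_idr in C1, C2; congruence. }
  split; [exact epi|]; intros a b m mono u v E.
  destruct (pbs _ _ _ m v) as (p & p1 & n & pb).
  destruct (ext _ n) as (n' & _ & N).
  - intros t f g E'; apply (pullback_eq pb); [|exact E'].
    apply mono; rewrite !comp_assoc, (proj1 pb), <- !comp_assoc, E'; reflexivity.
  - destruct (proj2 pb _ u e E) as (e' & [_ E'] & _); exists e'; exact E'.
  - assert (D : m ∘ (p1 ∘ n') = v).
    { rewrite comp_assoc, (proj1 pb), <- comp_assoc, N; apply comp_idr. }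
    exists (p1 ∘ n'); split.
    + split; [|exact D]; apply mono; rewrite comp_assoc, D; symmetry; exact E.
    + intros d [_ D']; apply mono; congruence.
Qed.

(** The object [x * b] is a point over [x] by the first projection and [(1, x -> b)].
    This section is the unit of the monad, and the pullback of [x * b] along [z -> x] is
    [T z = z * b]; so a subobject containing both is everything. *)
Lemma product_monad_essentially_nullary (C : category) (b : C) (P : products_with b) :
  has_finite_limits C -> protomodular C ->
  essentially_nullary (induced_monad (product_adjoint P)).
Proof.
  intros lim pm z x s i j k c _ _ Ci Cj.
  apply extremal_strong_epi; [exact (slice_finite_limits lim)|].
  intros w n mono [e' En]; apply slice_iso.
  apply (section_and_fibre_extremal (v := sh_mor k) (p := pw_fst P (so_ob x))
           (s := pw_pair P (idm (so_ob x)) (so_map x)) pm).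
  - apply pw_pair_fst.
  - exact (slice_mono mono).
  - exists (sh_mor e' ∘ sh_mor j).
    rewrite <- En in Cj; apply (f_equal (@sh_mor _ _ _ _)) in Cj; simpl in Cj.
    rewrite comp_assoc; exact Cj.
  - intros t a h E.
    exists (sh_mor e' ∘ (sh_mor i ∘ pw_pair P h (pw_snd P _ ∘ a))).
    rewrite <- En in Ci; apply (f_equal (@sh_mor _ _ _ _)) in Ci; simpl in Ci.
    transitivity (pw_map P (sh_mor k) ∘ pw_pair P h (pw_snd P _ ∘ a)).
    { rewrite <- Ci, <- !comp_assoc; reflexivity. }
    apply (pw_eq (p := P)).
    + rewrite comp_assoc, pw_map_fst, <- comp_assoc, pw_pair_fst; symmetry; exact E.
    + rewrite comp_assoc, pw_map_snd; apply pw_pair_snd.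
Qed.

(** * Monadicity of multiplication by a well-supported object *)

Lemma full_faithful_surjective_equivalence (C D : category) (F : functor C D) :
  (forall (x y : C) (f g : hom x y), fmap F f = fmap F g -> f = g) ->
  (forall (x y : C) (g : hom (F x) (F y)), exists f, fmap F f = g) ->
  (forall d : D, exists (c : C) (h : hom (F c) d), is_iso h) ->
  is_equivalence F.
Proof.
  intros faithful full surj.
  assert (S : forall d, { c : C & { h : hom (F c) d &
                          { h' : hom d (F c) | h' ∘ h = idm _ /\ h ∘ h' = idm _ }}}).
  { intros d; destruct (constructive_indefinite_description _ (surj d)) as [c H].
    exists c; destruct (constructive_indefinite_description _ H) as [h Hh].
    exists h; exact (constructive_indefinite_description _ Hh). }
  assert (L : forall x y (g : hom (F x) (F y)), { f | fmap F f = g }).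
  { intros x y g; exact (constructive_indefinite_description _ (full x y g)). }
  pose (G0 := fun d => projT1 (S d)).
  pose (h := fun d => projT1 (projT2 (S d)) : hom (F (G0 d)) d).
  pose (h' := fun d => proj1_sig (projT2 (projT2 (S d))) : hom d (F (G0 d))).
  assert (H1 : forall d, h' d ∘ h d = idm _)
    by (intros d; apply (proj2_sig (projT2 (projT2 (S d))))).
  assert (H2 : forall d, h d ∘ h' d = idm _)
    by (intros d; apply (proj2_sig (projT2 (projT2 (S d))))).
  pose (G1 := fun d e (g : hom d e) => proj1_sig (L (G0 d) (G0 e) (h' e ∘ (g ∘ h d)))).
  assert (EG : forall d e (g : hom d e), fmap F (G1 d e g) = h' e ∘ (g ∘ h d))
    by (intros d e g; apply (proj2_sig (L (G0 d) (G0 e) _))).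
  clearbody h h' G1.
  unshelve epose (G := @Functor D C G0 G1 _ _).
  { intros d; apply faithful; rewrite EG, comp_idl, H1; symmetry; apply fmap_id. }
  { intros d e k g f; apply faithful; rewrite (fmap_comp F), !EG.
    crw (H2 e); reflexivity. }
  exists G; split.
  - assert (K : forall c, { k : hom (G0 (F c)) c | fmap F k = h (F c) })
      by (intros c; apply L).
    unshelve eexists (@NatTrans C C (comp_functor G F) (id_functor C)
                        (fun c => proj1_sig (K c)) _).
    + intros x y f; simpl; apply faithful.
      rewrite !(fmap_comp F), (proj2_sig (K x)), (proj2_sig (K y)), EG.
      crw (H2 (F y)); reflexivity.
    + intros c; simpl; destruct (K c) as [k Ek]; simpl.
      destruct (L _ _ (h' (F c))) as [k' Ek']; exists k'; split; apply faithful;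
        rewrite (fmap_comp F), Ek, Ek', (fmap_id F); [apply H1 | apply H2].
  - unshelve eexists (@NatTrans D D (comp_functor F G) (id_functor D) h _).
    + intros x y f; simpl; rewrite EG; crw (H2 y); reflexivity.
    + intros d; exists (h' d); split; [apply H1 | apply H2].
Qed.

Lemma algebra_iso (X : category) (T : monad X) (x y : algebras T) (f : hom x y) :
  is_iso (ah_mor f) -> is_iso f.
Proof.
  intros (g & E1 & E2).
  unshelve eexists (@AlgebraHom X T y x g _).
  - rewrite <- (comp_idr (g ∘ alg_act y)), <- (fmap_id T), <- E2, (fmap_comp T).
    crw (eq_sym (ah_act f)); crw E1; reflexivity.
  - split; apply algebra_hom_eq; assumption.
Qed.

(** An algebra is an object [x] over [b] with a map [xi : x * b -> x] that moves an
    element to a prescribed fibre. The first projection and [xi] form a reflexive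
    relation on [x], hence an effective equivalence relation; let [q : x -> a] be its
    quotient. With [p : x -> b] the structure map, [(q, p) : x -> a * b] is an
    isomorphism: it is monic because the relation is the kernel pair of [q], and
    extremal because its composite with [xi] is [q * b], a regular epimorphism. *)
Lemma product_algebra (C : category) (b : C) (P : products_with b)
    (x : algebra (induced_monad (product_adjoint P))) :
  barr_exact C -> protomodular C ->
  exists (a : C) (h : @hom (algebras (induced_monad (product_adjoint P)))
                        x (comparison (product_adjoint P) a)), is_iso h.
Proof.
  intros [reg eff] pm.
  destruct x as [x act unit mult].
  pose (xi := sh_mor act : hom (pw_ob P (so_ob x)) (so_ob x)).
  assert (Xb : so_map x ∘ xi = pw_snd P (so_ob x)) by exact (sh_map act).
  assert (Xu : xi ∘ pw_pair P (idm _) (so_map x) = idm _)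
    by exact (f_equal (@sh_mor _ _ _ _) unit).
  pose (r := Span (pw_fst P (so_ob x)) xi).
  assert (Hr : is_reflexive_relation r).
  { split.
    - intros t u v E1 E2; simpl in *; apply (pw_eq (p := P)); [exact E1|].
      rewrite <- Xb, <- !comp_assoc, E2; reflexivity.
    - exists (pw_pair P (idm _) (so_map x)); split; [apply pw_pair_fst | exact Xu]. }
  destruct (eff _ _ (protomodular_maltsev (proj1 reg) pm Hr)) as (z & f & Hf).
  destruct (kernel_pair_coequalizer reg Hf) as (a & q & Hq & Kq & _).
  pose proof (proj1 Kq) as Eq; simpl in Eq.
  pose (m := pw_pair P q (so_map x)).
  assert (M1 : pw_fst P a ∘ m = q) by apply pw_pair_fst.
  assert (M2 : pw_snd P a ∘ m = so_map x) by apply pw_pair_snd.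
  assert (mono : is_mono m).
  { intros t u v E.
    destruct (proj2 (kernel_pair_related Kq u v)) as (w & W1 & W2); simpl in *.
    { rewrite <- M1, <- !comp_assoc, E; reflexivity. }
    rewrite <- (comp_idl u), <- W2, <- Xu, <- comp_assoc; f_equal.
    apply (pw_eq (p := P)); rewrite comp_assoc.
    - rewrite pw_pair_fst, W1; apply comp_idl.
    - rewrite pw_pair_snd, <- Xb, <- comp_assoc, W2, <- M2, <- !comp_assoc, E.
      reflexivity. }
  assert (Em : m ∘ xi = pw_map P q).
  { apply (pw_eq (p := P)).
    - rewrite comp_assoc, M1, pw_map_fst; symmetry; exact Eq.
    - rewrite comp_assoc, M2, pw_map_snd; exact Xb. }
  assert (iso : is_iso m).
  { destruct (@regular_epi_orthogonal C _ _ _ _ (pw_map P q) m xi (idm _)) as (d & _ & D).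
    - exact (proj2 (proj2 reg) _ _ _ _ _ _ _ _ (pw_map_pullback P q) Hq).
    - exact mono.
    - rewrite comp_idl; exact Em.
    - exact (mono_split_epi_iso mono D). }
  exists a.
  unshelve eexists (@AlgebraHom _ (induced_monad (product_adjoint P)) (Algebra unit mult)
    (comparison_ob (product_adjoint P) a)
    (@SliceHom C b x (SliceOb (pw_snd P a)) m M2) _).
  - apply slice_hom_eq; refine (eq_trans Em _); simpl; apply (pw_eq (p := P)).
    + rewrite comp_assoc, !pw_map_fst, <- comp_assoc, pw_map_fst, comp_assoc, M1.
      reflexivity.
    + rewrite comp_assoc, !pw_map_snd; reflexivity.
  - apply algebra_iso, slice_iso; exact iso.
Qed.

(** The comparison functor is full and faithful because each [a * b -> a] is a regular
    epimorphism, being a pullback of [b -> 1]. *)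
Lemma product_functor_monadic (C : category) (b : C) (P : products_with b) :
  barr_exact C -> protomodular C ->
  (forall (t : C) (f : hom b t), is_terminal t -> is_regular_epi f) ->
  monadic (product_adjoint P).
Proof.
  intros ex pm supp; pose proof ex as [reg _].
  assert (Hfst : forall a, is_regular_epi (pw_fst P a)).
  { intros a; destruct (finite_limits_terminal (proj1 reg)) as [t Ht].
    destruct (Ht b) as (f & _ & _), (Ht a) as (g & _ & _).
    refine (proj2 (proj2 reg) _ _ _ _ f g (pw_snd P a) (pw_fst P a) _ (supp t f Ht)).
    apply pullback_intro.
    - exact (exists_unique_eq (Ht _) I I).
    - intros u h k _; exists (pw_pair P k h); split; [apply pw_pair_snd | apply pw_pair_fst].
    - intros u v w E1 E2; apply (pw_eq (p := P)); assumption. }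
  apply full_faithful_surjective_equivalence.
  - intros x y f g E; apply (regular_epi_epi (Hfst x)).
    apply (f_equal (@ah_mor _ _ _ _)), (f_equal (@sh_mor _ _ _ _)) in E; simpl in E.
    rewrite <- !pw_map_fst, E; reflexivity.
  - intros x y [[g Gb] Ga]; simpl in g, Gb.
    apply (f_equal (@sh_mor _ _ _ _)) in Ga as G'; simpl in G'.
    destruct (kernel_pair_exists (pw_fst P x) (regular_has_pullbacks reg)) as [r Hr].
    destruct (proj2 (regular_epi_coequalizer (Hfst x) Hr) _ (pw_fst P y ∘ g))
      as (f & Ef & _).
    (* The kernel pair of [x * b -> x] is [(x * b) * b], on which the second projection
       becomes the algebra structure; so [g], a morphism of algebras, respects it. *)
    { pose (w := pw_pair P (sp_fst r) (pw_snd P x ∘ sp_snd r)).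
      assert (W : pw_map P (pw_fst P x) ∘ w = sp_snd r).
      { apply (pw_eq (p := P)).
        - rewrite comp_assoc, pw_map_fst, <- comp_assoc; unfold w; rewrite pw_pair_fst.
          exact (proj1 Hr).
        - rewrite comp_assoc, pw_map_snd; apply pw_pair_snd. }
      assert (K : pw_fst P y ∘ g ∘ pw_map P (pw_fst P x) = pw_fst P y ∘ g ∘ pw_fst P _).
      { transitivity (pw_fst P y ∘ (pw_map P (pw_fst P y) ∘ pw_map P g)).
        - rewrite <- comp_assoc; f_equal; exact G'.
        - rewrite comp_assoc, pw_map_fst, <- comp_assoc, pw_map_fst; apply comp_assoc. }
      rewrite <- W, comp_assoc, K, <- (comp_assoc _ (pw_fst P _) w); f_equal.
      symmetry; apply pw_pair_fst. }
    exists f; apply algebra_hom_eq, slice_hom_eq, (pw_eq (p := P)); simpl.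
    + rewrite pw_map_fst; exact Ef.
    + rewrite pw_map_snd; symmetry; exact Gb.
  - intros x; destruct (product_algebra x ex pm) as (a & h & h' & E1 & E2).
    exists a, h', h; auto.
Qed.

Lemma ideally_exact_monadic (A : category) :
  ideally_exact A ->
  exists (X : category) (U : functor A X) (F : left_adjoint U), ideal_monadic_functor F.
Proof.
  intros (ex & pm & cop & supp); pose proof ex as [reg _]; pose proof reg as [lim _].
  destruct (finite_coproducts_initial cop) as [z Hz].
  destruct (products_with_exist z (finite_limits_products lim)) as [P _].
  pose proof (product_monad_cartesian P) as cart.
  exists (slice z), (product_functor P), (product_adjoint P).
  split; [|split; [|split; [|split; [|split]]]].
  - split; [|split; [|split]].
    + exists (SliceOb (idm z)); exact (slice_zero_object Hz).
    + apply slice_barr_exact; exact ex.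
    + apply slice_protomodular; exact pm.
    + apply slice_finite_coproducts; exact cop.
  - apply product_functor_monadic; [exact ex | exact pm|].
    intros t f Ht; exact (supp z t f Hz Ht).
  - exact (product_monad_regular_epis P reg).
  - intros x y r f r1 r2; apply (proj1 cart).
  - exact cart.
  - exact (product_monad_essentially_nullary lim pm).
Qed.

Theorem theorem4p3 :
  (forall (A X : category) (U : functor A X) (F : left_adjoint U),
     barr_exact A -> semi_abelian X -> monadic F ->
     essentially_nullary (induced_monad F) ->
     forall a : A, lattices_canonically_isomorphic U a) /\
  (forall A : category, ideally_exact A ->
     (exists (X : category) (U : functor A X) (F : left_adjoint U),
        ideal_monadic_functor F) /\
     (forall (X : category) (U : functor A X) (F : left_adjoint U),
        ideal_monadic_functor F ->
        forall a : A, lattices_canonically_isomorphic U a)).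
Proof.
  split; [exact monadic_lattices|].
  intros A HA; split; [exact (ideally_exact_monadic HA)|].
  intros X U F (sab & mon & _ & _ & _ & nul).
  exact (monadic_lattices (proj1 HA) sab mon nul).
Qed.
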